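(* There exist a constant $c>0$ and an infinite family of graphs (with the number of vertices $n$ tending to infinity) such that for every graph $G$ in the family, with $n$ vertices, and for every Markov chain $\mathfrak{X}$ of JSV type on $G$, at least one of the following holds: (i) the stationary probability $\pi(\mathcal{P})$ of the set of perfect matchings is at most $e^{-cn}$; or (ii) the mixing time of $\mathfrak{X}$ is at least $e^{cn}$.
   Context: Let $G=(V,E)$ be a finite undirected graph. Let $\mathcal{P}$ be the set of perfect matchings of $G$, and for distinct $u,v\in V$ let $\mathcal{N}(u,v)$ be the set of near-perfect matchings with holes exactly at $u$ and $v$ (i.e., $u,v$ are the only unmatched vertices). The state space is $\Omega=\mathcal{P}\cup\bigcup_{u,v}\mathcal{N}(u,v)$. The hole pattern of $M\in\Omega$ is $\emptyset$ if $M\in\mathcal{P}$ and $\{u,v\}$ if $M\in\mathcal{N}(u,v)$. Broder proposal rule from $M\in\Omega$: (1) if $M\in\mathcal{P}$, choose an edge $e\in M$ uniformly at random and propose $M\setminus\{e\}$; (2) if $M\in\mathcal{N}(u,v)$, choose $x\in V$ uniformly at random. If $x\in\{u,v\}$ and $u$ is adjacent to $v$, propose $M\cup\{\{u,v\}\}$ (if $x\in\{u,v\}$ and $u,v$ are not adjacent, propose $M$). Otherwise let $y$ be the vertex matched to $x$ in $M$, choose $w\in\{u,v\}$ uniformly at random, and if $x$ is adjacent to $w$ propose $M\cup\{\{x,w\}\}\setminus\{\{x,y\}\}$ (otherwise propose $M$). A Markov chain of JSV type on $G$ is specified by a weight function $w:\Omega\to(0,\infty)$ that depends only on the hole pattern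 (i.e., $w(M)=w(M')$ whenever $M,M'$ have the same hole pattern); from state $M$ it draws a proposal $M'$ by the Broder rule and moves to $M'$ with probability $\min\{1,w(M')/w(M)\}$, otherwise stays at $M$. Its stationary distribution is $\pi(M)=w(M)/\sum_{N\in\Omega}w(N)$. The mixing time is $T_{\mathrm{mix}}=\max_{i\in\Omega}\min\{t: d_{TV}(P^t(i,\cdot),\pi)\le 1/4\}$, where $P$ is the transition matrix and $d_{TV}(\mu,\nu)=\frac12\sum_{x}|\mu(x)-\nu(x)|$. *)

(* Defs.v *)
From HB Require Import structures.
From mathcomp Require Import all_boot all_order all_algebra.
From mathcomp Require Import all_classical all_reals all_analysis.
Set Implicit Arguments.
Unset Strict Implicit.
Unset Printing Implicit Defensive.
Import Order.TTheory GRing.Theory Num.Theory.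
Local Open Scope ring_scope.

Record graph := Graph {
  vertex :> finType;
  adj : rel vertex;
  adj_sym : symmetric adj;
  adj_irr : irreflexive adj }.

Section Matchings.
Variable G : graph.

Definition edges : {set {set G}} :=
  [set e | [exists u : G, exists v : G, adj u v && (e == [set u; v])]].

Definition matching (M : {set {set G}}) : bool :=
  (M \subset edges) && finset.trivIset M.

(* The hole pattern: the set of vertices not covered by M. *)
Definition holes (M : {set {set G}}) : {set G} := ~: finset.cover M.

Definition perfect (M : {set {set G}}) : bool :=
  matching M && (holes M == finset.set0).

Definition near_perfect (u v : G) (M : {set {set G}}) : bool :=
  [&& u != v, matching M & holes M == [set u; v]].

Definition in_Omega (M : {set {set G}}) : bool :=
  perfect M || [exists u : G, exists v : G, near_perfect u v M].

Definition state : predArgType := {M : {set {set G}} | in_Omega M}.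
HB.instance Definition _ := Finite.on state.
HB.instance Definition _ := SubType.on state.

End Matchings.

Section Chain.
Variable R : realType.

(* Expectation of f under the uniform distribution on A; when f is the
   indicator of an event this is the probability of that event. *)
Definition unif (I : finType) (A : {set I}) (f : I -> R) : R :=
  (\sum_(i in A) f i) / #|A|%:R.

Variable G : graph.

(* Broder proposal from a near-perfect M when the vertex x is drawn.  With
   holes {u, v}, "u is adjacent to v" reads [holes M \in edges G], and
   [holes M |: M] is M together with the edge {u, v}.  If x is matched in M,
   [pblock M x] is the edge {x, y} of M containing x. *)
Definition broder_near (M : {set {set G}}) (x : G) (M' : {set {set G}}) : R :=
  if x \in holes M then
    (M' == if holes M \in edges G then holes M |: M else M)%:R
  else
    unif (holes M) (fun w : G =>
      (M' == if adj x w then ([set x; w] |: M) :\ finset.pblock M x else M)%:R).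

(* Probability that the Broder rule proposes M' from M. *)
Definition broder (M M' : {set {set G}}) : R :=
  if perfect M then unif M (fun e : {set G} => (M' == M :\ e)%:R)
  else unif [set: G] (fun x : G => broder_near M x M').

Definition jsv_weight (w : state G -> R) : Prop :=
  (forall M, 0 < w M) /\
  (forall M M', holes (val M) = holes (val M') -> w M = w M').

Definition accept (w : state G -> R) (M M' : state G) : R :=
  Num.min 1 (w M' / w M).

(* The second summand is the total probability of rejected proposals. *)
Definition jsv_prob (w : state G -> R) (M M' : state G) : R :=
  broder (val M) (val M') * accept w M M' +
  (M' == M)%:R *
    \sum_(N : state G) broder (val M) (val N) * (1 - accept w M N).

Definition stationary (w : state G -> R) (M : state G) : R :=
  w M / \sum_(N : state G) w N.

Definition stationary_perfect (w : state G -> R) : R :=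
  \sum_(M : state G | perfect (val M)) stationary w M.

End Chain.

Section Mixing.
Variables (R : realType) (S : finType).

Definition dTV (mu nu : S -> R) : R := 2^-1 * \sum_(x : S) `|mu x - nu x|.

Definition transition_mx (P : S -> S -> R) : 'M[R]_#|S| :=
  \matrix_(i, j) P (enum_val i) (enum_val j).

(* P^t(i, j) *)
Definition nstep (P : S -> S -> R) (t : nat) (i j : S) : R :=
  (transition_mx P ^+ t) (enum_rank i) (enum_rank j).

(* Extended-real valued: the minimum over an empty set of times is +oo, and
   over a nonempty set of times the infimum is attained.  The base value 0 of
   the maximum only matters when S is empty. *)
Definition mixing_time (P : S -> S -> R) (pi : S -> R) : \bar R :=
  \big[maxe/0%E]_(i : S)
    ereal_inf [set (t%:R)%:E | t in
      [set t : nat | dTV (nstep P t i) pi <= 4^-1]%classic]%classic.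

End Mixing.

Definition jsv_mixing_time (R : realType) (G : graph) (w : state G -> R) :
    \bar R :=
  mixing_time (jsv_prob w) (stationary w).

(* Main.v *)
(* The graph consists of four triangles and six chains, one for each edge of
   the complete graph on the triangles.  A chain is a half graph whose two
   extreme vertices (ports) lie in the triangles it joins.  If both ports are
   matched inside the chain, its matching is forced (the chain is "full");
   if both are matched in the triangles, it has at least 2^r matchings (the
   chain is "free").  By parity, a triangle matches none or two of its ports
   internally, so perfect matchings with only two full chains, which are then
   opposite, dominate.  They fall into three classes, one for each pair of
   opposite edges of the complete graph.

   A step out of the set of states all of whose full chains belong to a given
   pair makes another chain full.  The state it reaches has two holes, and
   rearranging the chains without holes yields
   matchings with the same holes and more free chains, 2^r times as many.  As
   the weight depends on the hole pattern only, these bottleneck states have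
   exponentially small stationary probability whatever the weights are, while
   the set and its complement both carry a constant fraction of the
   probability of the perfect matchings.  The bound on the mixing time follows by
   conductance. *)
Require Import Defs.
From mathcomp Require Import all_boot all_order all_algebra.
From mathcomp Require Import all_classical all_reals all_analysis.
From mathcomp Require Import lra zify.
From mathcomp Require Import finset.
Set Implicit Arguments.
Unset Strict Implicit.
Unset Printing Implicit Defensive.
Import Order.TTheory GRing.Theory Num.Theory.

(** * Reversible chains with a bottleneck *)

Section Conductance.
Local Open Scope ring_scope.
Variables (R : realType) (S : finType) (P : S -> S -> R) (pi : S -> R).
Variable A : {set S}.
Hypothesis P_ge0 : forall i j, 0 <= P i j.
Hypothesis P_sum : forall i, \sum_j P i j = 1.
Hypothesis pi_ge0 : forall i, 0 <= pi i.
Hypothesis pi_sum : \sum_i pi i = 1.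
Hypothesis reversible : forall i j, pi i * P i j = pi j * P j i.

Lemma nstep0 i j : nstep P 0 i j = (i == j)%:R.
Proof. by rewrite /nstep expr0 mxE (inj_eq enum_rank_inj). Qed.

Lemma nstepS t i j : nstep P t.+1 i j = \sum_k P i k * nstep P t k j.
Proof.
rewrite /nstep exprS -mulmxE mxE (reindex (@enum_rank S)) /=; last first.
  by apply: onW_bij; exact: enum_rank_bij.
by apply: eq_bigr => k _; rewrite mxE !enum_rankK.
Qed.

Lemma nstep_ge0 t i j : 0 <= nstep P t i j.
Proof.
elim: t i => [|t IH] i; first by rewrite nstep0 ler0n.
by rewrite nstepS sumr_ge0 // => k _; rewrite mulr_ge0.
Qed.

Lemma nstep_sum t i : \sum_j nstep P t i j = 1.
Proof.
elim: t i => [|t IH] i.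
  rewrite (bigD1 i) //= nstep0 eqxx big1 ?addr0 // => j /negbTE.
  by rewrite nstep0 eq_sym => ->.
under eq_bigr do rewrite nstepS.
rewrite exchange_big /= -[RHS](P_sum i); apply: eq_bigr => k _.
by rewrite -mulr_sumr IH mulr1.
Qed.

(** The excess of [mu] over [pi] on [A] equals its deficit off [A], so both halves of the sum are at
    least this excess, which offsets the factor 1/2. *)
Lemma dTV_ge (mu : S -> R) : \sum_i mu i = 1 ->
  \sum_(i in A) mu i - \sum_(i in A) pi i <= dTV mu pi.
Proof.
move=> mu1; set m := \sum_(i in A) mu i; set p := \sum_(i in A) pi i.
rewrite /dTV (bigID (mem A)) /=.
have h1 : m - p <= \sum_(i in A) `|mu i - pi i|.
  by rewrite -sumrB; apply: ler_sum => i _; apply: ler_norm.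
have h2 : m - p <= \sum_(i | i \notin A) `|mu i - pi i|.
  have -> : m - p = \sum_(i | i \notin A) pi i - \sum_(i | i \notin A) mu i.
    move: mu1 pi_sum; rewrite !(bigID (mem A) predT) /= -/m -/p => e1 e2.
    lra.
  by rewrite -sumrB; apply: ler_sum => i _; rewrite distrC ler_norm.
lra.
Qed.

(* The probability of being in A at each of the times 0, ..., t. *)
Fixpoint stay (t : nat) (i : S) : R :=
  (i \in A)%:R * (if t is t'.+1 then \sum_j P i j * stay t' j else 1).

Lemma stay_ge0 t i : 0 <= stay t i.
Proof.
elim: t i => [|t IH] i /=; first by rewrite mulr_ge0.
by rewrite mulr_ge0 // sumr_ge0 // => j _; rewrite mulr_ge0.
Qed.

Lemma stay_le1 t i : stay t i <= 1.
Proof.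
elim: t i => [|t IH] i /=; case: (i \in A); rewrite ?mul0r ?mul1r //.
by rewrite -(P_sum i); apply: ler_sum => j _; rewrite ler_piMr.
Qed.

Lemma stay_notin t i : i \notin A -> stay t i = 0.
Proof. by case: t => [|t] /negbTE /= ->; rewrite mul0r. Qed.

Lemma stay_decr t i : stay t.+1 i <= stay t i.
Proof.
elim: t i => [|t IH] i.
  case: (boolP (i \in A)) => [iA|/stay_notin h]; last by rewrite !h.
  by rewrite [leRHS]/= iA mulr1 stay_le1.
rewrite [leRHS]/= [leLHS]/= -/(stay t.+1) ler_wpM2l //.
by apply: ler_sum => j _; rewrite ler_wpM2l //; exact: IH.
Qed.

Lemma stay_mono s t i : (s <= t)%N -> stay t i <= stay s i.
Proof.
move=> /subnK <-; elim: (t - s)%N => [|d IH]; first by rewrite add0n.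
by rewrite addSn; apply: le_trans IH; exact: stay_decr.
Qed.

Lemma stay_le_nstep t i : stay t i <= \sum_(j in A) nstep P t i j.
Proof.
elim: t i => [|t IH] i /=.
  rewrite mulr1; case: (boolP (i \in A)) => iA; last first.
    by rewrite sumr_ge0 // => j _; exact: nstep_ge0.
  by rewrite (bigD1 i) //= nstep0 eqxx lerDl sumr_ge0 // => j _; exact: nstep_ge0.
rewrite [leRHS](eq_bigr _ (fun j _ => nstepS t i j)) exchange_big /=.
apply: (@le_trans _ _ (\sum_j P i j * stay t j)).
  case: (i \in A); rewrite ?mul1r // mul0r sumr_ge0 // => j _.
  by rewrite mulr_ge0 // stay_ge0.
apply: ler_sum => j _; rewrite -mulr_sumr ler_wpM2l //.
Qed.

Variable eps : R.
Hypothesis flow : \sum_(i in A) \sum_(j in ~: A) pi i * P i j <= eps.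

(** Started from [pi] restricted to [A], the chain loses at most the flow out of [A] in each step.
    By reversibility, the mass arriving at [j] from [A] is [pi j] minus what [j] sends out of
    [A]. *)
Lemma stay_avg t :
  \sum_(i in A) pi i - t%:R * eps <= \sum_(i in A) pi i * stay t i.
Proof.
elim: t => [|t IH].
  rewrite mul0r subr0 ler_sum // => i iA; by rewrite /= iA !mulr1.
have -> : \sum_(i in A) pi i * stay t.+1 i =
    \sum_(j in A) pi j * stay t j - 
    \sum_(j in A) (\sum_(i in ~: A) pi j * P j i) * stay t j.
  rewrite -sumrB.
  transitivity (\sum_(i in A) \sum_(j in A) pi j * P j i * stay t j).
    apply: eq_bigr => i iA; rewrite /= iA mul1r mulr_sumr.
    rewrite (bigID (mem A)) /= [X in _ + X]big1 ?addr0; last first.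
      by move=> j jA; rewrite stay_notin // !mulr0.
    by apply: eq_bigr => j jA; rewrite mulrA reversible.
  rewrite exchange_big /=; apply: eq_bigr => j jA.
  rewrite -mulr_suml -mulrBl; congr (_ * _).
  apply/esym/eqP; rewrite subr_eq -[eqbLHS]mulr1 -(P_sum j) mulr_sumr.
  rewrite (bigID (mem A)) /=; apply/eqP; congr (_ + _).
  by apply: eq_bigl => i; rewrite in_setC.
have : \sum_(j in A) (\sum_(i in ~: A) pi j * P j i) * stay t j <= eps.
  apply: le_trans flow; apply: ler_sum => j _.
  by rewrite ler_piMr ?stay_le1 // sumr_ge0 // => i _; rewrite mulr_ge0.
move: IH; rewrite -natr1; lra.
Qed.

(** Started from [pi] restricted to [A], the chain leaves [A] by time [T] with conditional
    probability below 1/4, so some start in [A] stays with probability above 3/4. As [A] has mass at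
    most 1/2, the distance to [pi] still exceeds 1/4. *)
Lemma conductance_mixing (T : R) :
  0 <= T -> 0 < \sum_(i in A) pi i -> \sum_(i in A) pi i <= 2^-1 ->
  T * eps < 4^-1 * \sum_(i in A) pi i ->
  (T%:E <= mixing_time P pi)%E.
Proof.
move=> T0 A0 A2 Teps; set a := \sum_(i in A) pi i in A0 A2 Teps.
(* No time up to [t0] is mixed for the start found below, so its mixing time is at least
   [t0 + 1 > T]. *)
set t0 := Num.truncn T.
have t0T : t0%:R <= T by have := truncn_itv T0 => /andP[].
have Tt0 : T < t0.+1%:R by have := truncn_itv T0 => /andP[].
have eps0 : 0 <= eps.
  apply: le_trans flow; rewrite sumr_ge0 // => i _; rewrite sumr_ge0 // => j _.
  by rewrite mulr_ge0.
have t0eps : t0%:R * eps < 4^-1 * a by apply: le_lt_trans Teps; rewrite ler_wpM2r.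
have [i iA hi] : exists2 i, i \in A & 3 / 4 < stay t0 i.
  apply/exists_inP; apply: contraPT (stay_avg t0) => /exists_inPn h.
  apply/negP; rewrite -ltNge.
  have : \sum_(i in A) pi i * stay t0 i <= 3 / 4 * a.
    rewrite mulr_sumr; apply: ler_sum => i iA; rewrite mulrC.
    by rewrite ler_wpM2r // leNgt; exact: h.
  rewrite -/a; lra.
rewrite /mixing_time; apply: le_trans (le_bigmax _ _ i).
apply: le_ereal_inf_tmp => _ [t /= ht <-]; rewrite lee_fin.
apply: ltW; apply: lt_le_trans Tt0 _; rewrite ler_nat ltnNge; apply/negP => tt0.
have := dTV_ge (nstep_sum t i); rewrite -/a.
have := stay_le_nstep t i; have := stay_mono i tt0.
lra.
Qed.

End Conductance.

(** * Conductance bounded by the mass of the boundary states *)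

Section Bottleneck.
Local Open Scope ring_scope.
Variables (R : realType) (S : finType) (P : S -> S -> R) (pi : S -> R).
Hypothesis P_ge0 : forall i j, 0 <= P i j.
Hypothesis P_sum : forall i, \sum_j P i j = 1.
Hypothesis pi_ge0 : forall i, 0 <= pi i.
Hypothesis pi_sum : \sum_i pi i = 1.
Hypothesis reversible : forall i j, pi i * P i j = pi j * P j i.

Lemma bottleneck_mixing (A B : {set S}) (a T : R) :
  (forall i j, i \in A -> j \notin A -> P i j != 0 -> j \in B) ->
  0 < a -> a <= \sum_(i in A) pi i -> a <= \sum_(i in ~: A) pi i ->
  0 <= T -> T * \sum_(i in B) pi i < 4^-1 * a ->
  (T%:E <= mixing_time P pi)%E.
Proof.
move=> AB a0 aA aC T0 TB; set eps := \sum_(i in B) pi i in TB.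
(* Every transition out of [A] ends in [B]. By reversibility the flow from [A] into [j] is [pi j]
   times the probability of moving from [j] into [A], hence at most [pi j]. *)
have flow : \sum_(i in A) \sum_(j in ~: A) pi i * P i j <= eps.
  rewrite exchange_big /= /eps [leLHS](bigID (mem B)) /= addrC big1 ?add0r.
    apply: (@le_trans _ _ (\sum_(j in ~: A | j \in B) pi j)).
      apply: ler_sum => j _; under eq_bigr do rewrite reversible.
      rewrite -mulr_sumr ler_piMr // -(P_sum j) [leRHS](bigID (mem A)) /=.
      by rewrite lerDl sumr_ge0.
    rewrite [leRHS](bigID (mem (~: A))) /=.
    rewrite (eq_bigl (fun j => (j \in B) && (j \in ~: A))); last first.
      by move=> j; rewrite andbC.
    by rewrite lerDl sumr_ge0.
  move=> j /andP[]; rewrite in_setC => jA jB; apply: big1 => i iA.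
  apply/eqP; rewrite mulf_eq0 orbC.
  case: (boolP (P i j == 0)) => //= h; by rewrite (AB i j) in jB.
have lin (x : R) : a <= x -> T * eps < 4^-1 * x by lra.
(* The conductance bound requires a set of mass at most 1/2, which is [A] or its complement;
   reversibility makes the flow the same in both directions. *)
have [A2|A2] := leP (\sum_(i in A) pi i) 2^-1.
  apply: (conductance_mixing P_ge0 P_sum pi_ge0 pi_sum reversible flow) => //.
    exact: lt_le_trans aA.
  exact: lin.
apply: (@conductance_mixing _ _ P pi (~: A) P_ge0 P_sum pi_ge0 pi_sum
  reversible eps) => //.
- rewrite setCK; apply: le_trans flow; rewrite exchange_big /=.
  by apply: ler_sum => i _; apply: ler_sum => j _; rewrite reversible.
- exact: lt_le_trans aC.
- move: pi_sum; rewrite (bigID (mem A)) /=.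
  rewrite [X in _ + X](eq_bigl (fun i => i \in ~: A)); first lra.
  by move=> i; rewrite in_setC.
- exact: lin.
Qed.

End Bottleneck.

(** * Matchings as involutions, and the Broder rule *)

Section Mates.
Variable G : graph.
Implicit Types (M : {set {set G}}) (x y z : G) (f : {ffun G -> G}).

Lemma adj_neq x y : adj x y -> x != y.
Proof. by apply: contraTneq => ->; rewrite adj_irr. Qed.

Lemma set2_eq (T : finType) (x y u v : T) : [set x; y] = [set u; v] ->
  x != y -> (x = u /\ y = v) \/ (x = v /\ y = u).
Proof.
move=> e xy.
have : x \in [set u; v] by rewrite -e set21.
have : y \in [set u; v] by rewrite -e set22.
have : u \in [set x; y] by rewrite e set21.
have : v \in [set x; y] by rewrite e set22.
rewrite !in_set2.
by move=> /orP[]/eqP ? /orP[]/eqP ? /orP[]/eqP ? /orP[]/eqP ?; subst;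
  rewrite ?eqxx in xy *; auto.
Qed.

Lemma edgesE x y : ([set x; y] \in edges G) = adj x y.
Proof.
apply/idP/idP; last first.
  by move=> xy; rewrite inE; apply/existsP; exists x; apply/existsP; exists y; rewrite xy /=.
rewrite inE => /existsP[u /existsP[v /andP[uv /eqP e]]].
have [] := set2_eq (esym e) (adj_neq uv) => -[? ?]; subst => //.
by rewrite adj_sym.
Qed.

(** A matching as an involution whose fixed points are the holes. *)
Definition mate M : {ffun G -> G} :=
  [ffun x => odflt x [pick y | [set x; y] \in M]].

Definition involutive_matching f :=
  [forall x, (f (f x) == x) && ((f x == x) || adj x (f x))].

Definition of_mate f : {set {set G}} :=
  [set e | [exists x, (f x != x) && (e == [set x; f x])]].

Lemma of_mateP f (e : {set G}) :
  reflect (exists2 x, f x != x & e = [set x; f x]) (e \in of_mate f).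
Proof.
rewrite inE; apply: (iffP existsP) => [[x /andP[h /eqP ->]]|[x h ->]].
  by exists x.
by exists x; rewrite h eqxx.
Qed.

Section Matching.
Variable M : {set {set G}}.
Hypothesis hM : matching M.

Lemma matching_adj x y : [set x; y] \in M -> adj x y.
Proof. by case/andP: hM => /fintype.subsetP sub _ /sub; rewrite edgesE. Qed.

Lemma matching_inj x (e e' : {set G}) :
  e \in M -> e' \in M -> x \in e -> x \in e' -> e = e'.
Proof.
case/andP: hM => _ /trivIsetP tI eM e'M xe xe'; apply/eqP.
apply/negPn/negP => /(tI _ _ eM e'M) /pred0P /(_ x) /=.
by rewrite xe xe'.
Qed.

Lemma matchingE (e : {set G}) :
  e \in M -> exists x y, adj x y /\ e = [set x; y].
Proof.
case/andP: hM => /fintype.subsetP sub _ /sub.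
rewrite inE => /existsP[u /existsP[v /andP[uv /eqP e']]].
by exists u, v.
Qed.

Lemma mate_eq x y : [set x; y] \in M -> mate M x = y.
Proof.
move=> h; rewrite ffunE; case: pickP => [z /= hz|/(_ y)]; last by rewrite h.
have := matching_inj h hz (set21 _ _) (set21 _ _) => e.
have [[_ ->]//|[xz _]] := set2_eq e (adj_neq (matching_adj h)).
by move: (adj_neq (matching_adj hz)); rewrite xz eqxx.
Qed.

Lemma holesP x : (x \in holes M) = (mate M x == x).
Proof.
rewrite in_setC /cover; apply/idP/eqP => h; last first.
  apply/negP => /bigcupP[e eM xe].
  have [u [v [uv e']]] := matchingE eM; subst e.
  move: xe; rewrite in_set2 => /orP[] /eqP ?; subst x.
    by move: (mate_eq eM) (adj_neq uv); rewrite h => ->; rewrite eqxx.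
  move: eM; rewrite setUC => eM.
  by move: (mate_eq eM) (adj_neq uv); rewrite h => ->; rewrite eqxx.
rewrite ffunE; case: pickP => //= y hy; case/negP: h.
by apply/bigcupP; exists [set x; y] => //; rewrite set21.
Qed.

Lemma mate_edge x : mate M x != x -> [set x; mate M x] \in M.
Proof.
by rewrite ffunE; case: pickP => [y hy //|_] /=; rewrite eqxx.
Qed.

Lemma mateK x : mate M (mate M x) = x.
Proof.
have [e|/mate_edge h] := eqVneq (mate M x) x; first by rewrite !e.
by apply: mate_eq; rewrite setUC.
Qed.

Lemma mate_adj x : mate M x != x -> adj x (mate M x).
Proof. by move/mate_edge/matching_adj. Qed.

Lemma mate_involutive : involutive_matching (mate M).
Proof.
apply/forallP => x; rewrite mateK eqxx /=.
by case: eqVneq => //= /mate_adj.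
Qed.

Lemma mateM_of : of_mate (mate M) = M.
Proof.
apply/setP => e; apply/of_mateP/idP => [[x h ->]|eM]; first exact: mate_edge.
have [x [y [xy e']]] := matchingE eM; subst e.
by exists x; rewrite (mate_eq eM) // eq_sym adj_neq.
Qed.

Lemma pblock_mate x : mate M x != x -> pblock M x = [set x; mate M x].
Proof.
move=> h; apply: def_pblock; rewrite ?set21 ?mate_edge //.
by case/andP: hM.
Qed.

Lemma holes_notin : holes M != set0 -> holes M \notin M.
Proof.
case/set0Pn => x; rewrite in_setC => h; apply: contra (h) => hh.
by rewrite /cover; apply/bigcupP; exists (holes M) => //; rewrite in_setC.
Qed.

End Matching.

Section OfMate.
Variable f : {ffun G -> G}.
Hypothesis hf : involutive_matching f.

Lemma invK x : f (f x) = x.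
Proof. by case/andP: (forallP hf x) => /eqP. Qed.

Lemma inv_adj x : f x != x -> adj x (f x).
Proof. by case/andP: (forallP hf x) => _ /orP[->|]. Qed.

Lemma of_mate_matching : matching (of_mate f).
Proof.
apply/andP; split.
  by apply/fintype.subsetP => e /of_mateP[x h ->]; rewrite edgesE inv_adj.
apply/trivIsetP => _ _ /of_mateP[x hx ->] /of_mateP[y hy ->].
apply: contraNT => /pred0Pn[z] /=; rewrite !in_set2.
case/andP => /orP[]/eqP -> /orP[]/eqP => [-> // | -> | <- | e].
- by rewrite invK setUC.
- by rewrite invK setUC.
- by rewrite -(invK x) e invK.
Qed.

Lemma mate_of : mate (of_mate f) = f.
Proof.
apply/ffunP => x; have [e|h] := eqVneq (f x) x; last first.
  by apply: (mate_eq of_mate_matching); apply/of_mateP; exists x.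
rewrite e ffunE; case: pickP => //= y /of_mateP[z hz e'].
have zz := adj_neq (inv_adj hz).
have : x \in [set z; f z] by rewrite -e' set21.
rewrite in_set2 => /orP[]/eqP ?; subst x.
  by rewrite e eqxx in zz.
by move: e; rewrite invK => e; rewrite -e eqxx in zz.
Qed.

Lemma holes_of : holes (of_mate f) = [set x | f x == x].
Proof.
by apply/setP => x; rewrite (holesP of_mate_matching) mate_of inE.
Qed.

End OfMate.

Lemma in_OmegaE M :
  in_Omega M = matching M && ((#|holes M| == 0)%N || (#|holes M| == 2)%N).
Proof.
rewrite /in_Omega /perfect /near_perfect cards_eq0.
case: (boolP (matching M)) => //= hM; last first.
  by apply/negbTE/negP => /existsP[u /existsP[v]]; rewrite andbF.
congr (_ || _); apply/existsP/cards2P => [[u /existsP[v /andP[uv /eqP e]]]|].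
  by exists u, v.
by case=> u [v [uv ->]]; exists u; apply/existsP; exists v; rewrite uv /=.
Qed.

Lemma in_Omega_matching M : in_Omega M -> matching M.
Proof. by rewrite in_OmegaE => /andP[]. Qed.

Lemma perfectE M : perfect M = matching M && (#|holes M| == 0)%N.
Proof. by rewrite /perfect cards_eq0. Qed.

(** The effect of a Broder exchange on mates: the hole [w] is matched with [x], and the former mate
    of [x] becomes a hole. *)
Definition slide f x w : {ffun G -> G} :=
  [ffun z => if z == x then w else if z == w then x
             else if z == f x then z else f z].

Definition erase f x : {ffun G -> G} :=
  [ffun z => if (z == x) || (z == f x) then z else f z].

Lemma slide_involutive f x w : involutive_matching f -> f x != x -> f w = w ->
  adj x w -> involutive_matching (slide f x w).
Proof.
move=> hf hx hw xw; have wx := adj_neq xw; have K := invK hf.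
apply/forallP => z; rewrite !ffunE.
have [->|zx] := eqVneq z x.
  by rewrite eqxx [w == x]eq_sym (negbTE wx) eqxx xw orbT.
have [->|zw] := eqVneq z w; first by rewrite !eqxx adj_sym xw orbT.
have [->|zfx] := eqVneq z (f x).
  rewrite (negbTE hx) eqxx /= ; case: (eqVneq (f x) w) => [e|_]; last by rewrite eqxx.
  by rewrite -(K x) e hw eqxx in wx.
have -> : f z == x = false.
  by apply: contraNF zfx => /eqP <-; rewrite K.
have -> : f z == w = false by apply: contraNF zw => /eqP e; rewrite -(K z) e hw.
have -> : f z == f x = false.
  by apply: contraNF zx => /eqP e; rewrite -(K z) e K.
rewrite K eqxx /=; case: (eqVneq (f z) z) => //= h.
exact: (inv_adj hf).
Qed.

Lemma slide_proposal M x w : matching M -> x \notin holes M ->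
  w \in holes M -> adj x w ->
  ([set x; w] |: M) :\ pblock M x = of_mate (slide (mate M) x w).
Proof.
move=> hM; rewrite !(holesP hM) => hx /eqP hw xw.
have wx := adj_neq xw; have K := mateK hM.
rewrite (pblock_mate hM hx); set f := mate M in hx hw K *.
apply/setP => e; rewrite in_setD1 in_setU1.
apply/idP/of_mateP => [/andP[ne /predU1P[->|eM]]|[z]].
- by exists x; rewrite ffunE eqxx // eq_sym.
- have [y [z [yz e']]] := matchingE hM eM; subst e.
  have fy : f y = z by exact: mate_eq.
  have fz : f z = y by rewrite -fy.
  have yx : y != x by apply: contraNneq ne => yx; rewrite -yx fy.
  have zx : z != x by apply: contraNneq ne => zx; rewrite -zx fz setUC.
  have yw : y != w.
    by apply: contraTneq yz => e; rewrite -fy e hw adj_irr.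
  have yfx : y != f x by apply: contraNneq zx => e; rewrite -fy e K.
  exists y; rewrite ffunE (negbTE yx) (negbTE yw) (negbTE yfx) fy //.
  by rewrite eq_sym adj_neq.
rewrite ffunE; have [->|zx] := eqVneq z x.
  move=> _ ->; rewrite eqxx andbT; apply: contraNneq (wx) => ee.
  have [[_ e']|[_ ->]] := set2_eq ee wx; last by rewrite eqxx.
  by rewrite -[x in x == _]K -e' hw eqxx.
have [->|zw] := eqVneq z w.
  move=> _ ->; rewrite [ [set w; x] ]setUC eqxx andbT; apply: contraNneq (wx) => ee.
  have [[_ e']|[_ ->]] := set2_eq ee wx; last by rewrite eqxx.
  by rewrite -[x in x == _]K -e' hw eqxx.
have [->|zfx] := eqVneq z (f x); first by rewrite eqxx.
move=> h ->; rewrite (mate_edge h) orbT andbT.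
apply: contraNneq zx => ee; have fz : z != f z by rewrite eq_sym.
have [[-> _]|[e' _]] := set2_eq ee fz; first by rewrite eqxx.
by rewrite e' eqxx in zfx.
Qed.

Lemma erase_involutive f x : involutive_matching f ->
  involutive_matching (erase f x).
Proof.
move=> hf; have K := invK hf; apply/forallP => z; rewrite !ffunE.
case: (boolP ((z == x) || (z == f x))) => [zx|/negbTE zx] /=.
  by rewrite zx /= !eqxx.
have -> : (f z == x) || (f z == f x) = false.
  apply: contraFF zx => /orP[/eqP<-|/eqP e]; first by rewrite K eqxx orbT.
  by rewrite -(K z) e K eqxx.
rewrite K eqxx /=; case: (eqVneq (f z) z) => //= h.
exact: (inv_adj hf).
Qed.

Lemma erase_proposal M x : matching M ->
  M :\ [set x; mate M x] = of_mate (erase (mate M) x).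
Proof.
move=> hM; have K := mateK hM; set f := mate M in K *.
apply/setP => e; rewrite in_setD1; apply/idP/of_mateP => [/andP[ne eM]|[z]].
  have [y [z [yz e']]] := matchingE hM eM; subst e.
  have fy : f y = z by exact: mate_eq.
  have yF : (y == x) || (y == f x) = false.
    apply: contraNF ne => /orP[]/eqP ye; first by rewrite -ye fy.
    by rewrite -fy ye K setUC.
  by exists y; rewrite ffunE yF fy // eq_sym adj_neq.
rewrite ffunE; case: ifP => [_|zx]; first by rewrite eqxx.
move=> h ->; rewrite (mate_edge h) andbT.
apply: contraFneq zx => ee; have fz : z != f z by rewrite eq_sym.
by have [[-> _]|[-> _]] := set2_eq ee fz; rewrite eqxx ?orbT.
Qed.

End Mates.

(** * The Broder proposal in terms of mates, and its symmetry *)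

Section Broder.
Local Open Scope ring_scope.
Variables (R : realType) (G : graph).
Implicit Types (M : {set {set G}}) (x y z : G) (f : {ffun G -> G}).

(** A slide at [x], phrased symmetrically: the mate of [x] in each function is a hole of the other,
    and all else agrees. The symmetry of the proposals rests on this form. *)
Definition slide_step f f' x := [&& f x != x, f' x != x, f (f' x) == f' x,
  f' (f x) == f x & [forall z, [|| z == x, z == f x, z == f' x | f z == f' z]]].

Lemma slide_step_sym f f' x : slide_step f f' x = slide_step f' f x.
Proof.
suff imp g g' : slide_step g g' x -> slide_step g' g x by apply/idP/idP; exact: imp.
case/and5P => h1 h2 h3 h4 /forallP h5; apply/and5P; split => //.
apply/forallP => z.
by case/or4P: (h5 z) => [->|->|->|/eqP->]; rewrite ?eqxx ?orbT.
Qed.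

(** A slide from [f] to [f'] at [x] determines its hole, which must be the new mate [f' x]. So for
    each drawn [x] at most one of the two holes leads to [f']. *)
Lemma slide_stepP f f' x w : involutive_matching f -> involutive_matching f' ->
  f x != x -> f w = w ->
  adj x w && (f' == slide f x w) = (w == f' x) && slide_step f f' x.
Proof.
move=> hf hf' hx hw; have K := invK hf; apply/andP/andP.
  move=> [xw /eqP ->]; have wx := adj_neq xw.
  have fxw : f x != w by apply: contraNneq wx => e; rewrite -[x in x == _]K e hw.
  split; first by rewrite ffunE eqxx.
  apply/and5P; split; rewrite ?ffunE ?eqxx //.
  - by rewrite eq_sym.
  - by rewrite hw.
  - by rewrite (negbTE hx) (negbTE fxw).
  - apply/forallP => z; rewrite ffunE.
    case: (eqVneq z x) => //=; case: (eqVneq z (f x)) => //=.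
    by case: (eqVneq z w) => //=.
move=> [/eqP-> /and5P[_ h2 /eqP h3 /eqP h4 /forallP h5]].
split; first exact: inv_adj.
apply/eqP/ffunP => z; rewrite ffunE.
have [->//|zx] := eqVneq z x.
have [->|zw] := eqVneq z (f' x); first by rewrite (invK hf').
have [->//|zfx] := eqVneq z (f x).
by move: (h5 z); rewrite (negbTE zx) (negbTE zw) (negbTE zfx) /= => /eqP.
Qed.

Lemma card_holes_slide f x w : involutive_matching f -> f x != x -> f w = w ->
  adj x w -> #|holes (of_mate (slide f x w))| = #|holes (of_mate f)|.
Proof.
move=> hf hx hw xw; have K := invK hf; have wx := adj_neq xw.
rewrite !holes_of //; last exact: slide_involutive.
have fxw : f x != w by apply: contraNneq wx => e; rewrite -[x in x == _]K e hw.
have -> : [set z | slide f x w z == z] = f x |: ([set z | f z == z] :\ w).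
  apply/setP => z; rewrite in_setU1 in_setD1 !inE ffunE.
  have [->|zx] := eqVneq z x.
    by rewrite [w == x]eq_sym (negbTE wx) [x == f x]eq_sym (negbTE hx).
  have [->|zw] := eqVneq z w.
    by rewrite (negbTE wx) [w == _]eq_sym (negbTE fxw).
  by case: (eqVneq z (f x)) => //=; rewrite eqxx.
rewrite cardsU1 in_setD1 fxw inE K eq_sym hx /= [RHS](cardsD1 w).
by rewrite inE hw eqxx.
Qed.

Definition near M := in_Omega M && ~~ perfect M.

Lemma nearP M : near M -> matching M /\ #|holes M| = 2%N.
Proof.
rewrite /near in_OmegaE perfectE => /andP[/andP[-> /orP[->|/eqP->]]] //.
Qed.

Lemma near_neq0 M : near M -> holes M != set0.
Proof. by case/nearP => _ h; rewrite -card_gt0 h. Qed.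

Lemma near_slide M x w : near M -> x \notin holes M -> w \in holes M ->
  adj x w -> near (([set x; w] |: M) :\ pblock M x).
Proof.
move=> nM xM wM xw; have [hM h2] := nearP nM.
rewrite slide_proposal // /near in_OmegaE perfectE.
move: xM wM; rewrite !holesP // => hx /eqP hw.
have hf := mate_involutive hM.
rewrite card_holes_slide // mateM_of // h2 /= !andbT.
by rewrite of_mate_matching // ?slide_involutive.
Qed.

Lemma perfect_add M : near M -> holes M \in edges G -> perfect (holes M |: M).
Proof.
move=> nM hE; have [hM h2] := nearP nM; case/andP: (hM) => sub tI.
have dis (B : {set G}) : B \in M -> [disjoint holes M & B].
  move=> BM; rewrite disjoints_subset; apply/fintype.subsetP => z.
  rewrite !in_setC; apply: contra => zB.
  by rewrite /cover; apply/bigcupP; exists B.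
have n0 : set0 \notin M.
  apply/negP => /(matchingE hM)[u [v [_ e]]].
  by have := set21 u v; rewrite -e inE.
apply/andP; split; first (apply/andP; split).
- by apply/fintype.subsetP => e /setU1P[->//|]; exact: (fintype.subsetP sub).
- exact: (trivIsetU1 dis tI n0).1.
- rewrite /holes /cover big_setU1 /=; last exact: (trivIsetU1 dis tI n0).2.
  by rewrite -/(cover M) /holes setUC setUCr setCT.
Qed.

Lemma perfect_hole M x : perfect M -> mate M x != x.
Proof.
rewrite /perfect => /andP[hM /eqP h0].
by rewrite -(holesP hM) h0 inE.
Qed.

Lemma near_erase M (e : {set G}) : perfect M -> e \in M -> near (M :\ e) /\ holes (M :\ e) = e.
Proof.
move=> pM eM; have hM : matching M by case/andP: pM.
have [x [y [xy ee]]] := matchingE hM eM; subst e.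
have fx := mate_eq hM eM; subst y.
have hf := mate_involutive hM.
have hh : holes (M :\ [set x; mate M x]) = [set x; mate M x].
  rewrite erase_proposal // holes_of ?erase_involutive //.
  apply/setP => z; rewrite in_set2 inE ffunE.
  case: ifP => [_|_]; first by rewrite eqxx.
  exact/negbTE/perfect_hole.
split => //; rewrite /near in_OmegaE perfectE hh cards2 adj_neq //=.
by rewrite erase_proposal // of_mate_matching ?erase_involutive // .
Qed.

Lemma unif_const (I : finType) (A : {set I}) (c : R) : A != set0 ->
  unif A (fun=> c) = c.
Proof.
move=> A0; rewrite /unif sumr_const -[c *+ _]mulr_natr mulfK // pnatr_eq0.
by rewrite cards_eq0.
Qed.

Lemma eq_unif (I : finType) (A : {set I}) (g g' : I -> R) : {in A, g =1 g'} ->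
  unif A g = unif A g'.
Proof. by move=> e; congr (_ / _); apply: eq_bigr. Qed.

Lemma unif_sum (I J : finType) (A : {set I}) (g : J -> I -> R) :
  \sum_j unif A (g j) = unif A (fun i => \sum_j g j i).
Proof. by rewrite /unif -mulr_suml exchange_big. Qed.

Lemma unif_ge0 (I : finType) (A : {set I}) (g : I -> R) :
  (forall i, 0 <= g i) -> 0 <= unif A g.
Proof. by move=> g0; rewrite mulr_ge0 ?invr_ge0 // sumr_ge0. Qed.

Lemma broder_ge0 M M' : 0 <= broder R M M'.
Proof.
rewrite /broder; case: ifP => _; apply: unif_ge0 => // x.
by rewrite /broder_near; case: ifP => // _; apply: unif_ge0.
Qed.

Lemma sum_state M : in_Omega M -> \sum_(M' : state G) (val M' == M)%:R = 1 :> R.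
Proof.
move=> h; rewrite (bigD1 (Sub M h : state G)) //= eqxx big1 ?addr0 // => M' ne.
by rewrite (_ : (_ == M) = false) //; apply: contraNF ne => /eqP e; apply/eqP/val_inj.
Qed.

Lemma broder_sum M : (0 < #|G|)%N -> in_Omega M ->
  \sum_(M' : state G) broder R M (val M') = 1.
Proof.
move=> /card_gt0P[x0 _] hO; have hM := in_Omega_matching hO.
have [pM|pM] := boolP (perfect M).
  under eq_bigr do rewrite /broder pM.
  rewrite unif_sum (eq_unif (g' := fun=> 1)); last first.
    by move=> e eM; rewrite sum_state //; case: (near_erase pM eM) => /andP[].
  apply: unif_const; apply/set0Pn; exists [set x0; mate M x0].
  by rewrite mate_edge // perfect_hole.
have nM : near M by rewrite /near hO.
under eq_bigr do rewrite /broder (negbTE pM).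
rewrite unif_sum (eq_unif (g' := fun=> 1)); last first.
  move=> x _; rewrite /broder_near.
  case: (boolP (x \in holes M)) => xM.
    apply: sum_state; case: ifP => // hE.
    by rewrite /in_Omega perfect_add.
  rewrite unif_sum (eq_unif (g' := fun=> 1)) ?unif_const ?near_neq0 //.
  move=> w wM; apply: sum_state; case: ifP => // xw.
  by case/andP: (near_slide nM xM wM xw).
by apply: unif_const; apply/set0Pn; exists x0; rewrite inE.
Qed.

(** When a hole is drawn, the proposal is [M] itself or perfect. Hence only slides contribute, each
    with exactly one of the two holes. *)
Lemma broder_nearE M M' : near M -> near M' -> M != M' ->
  broder R M M' = (\sum_x (slide_step (mate M) (mate M') x)%:R / 2) / #|G|%:R.
Proof.
move=> nM nM' MM'; have [hM h2] := nearP nM; have [hM' _] := nearP nM'.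
have hf := mate_involutive hM; have hf' := mate_involutive hM'.
rewrite /broder ifF; last by apply/negbTE; case/andP: nM.
rewrite /unif cardsT; congr (_ / _).
rewrite (eq_bigl predT); last by move=> x; rewrite inE.
apply: eq_bigr => x _; rewrite /broder_near.
have [xM|xM] := boolP (x \in holes M).
  rewrite (_ : slide_step _ _ _ = false) ?mul0r; last first.
    by rewrite /slide_step -(holesP hM) xM.
  case: ifP => [hE|_]; last by rewrite eq_sym (negbTE MM').
  rewrite (_ : (_ == _) = false) //; apply: contraTF nM' => /eqP ->.
  by rewrite /near perfect_add // andbF.
rewrite /unif h2; congr (_ / _).
have fx : mate M x != x by rewrite -holesP.
transitivity (\sum_(w in holes M)
    ((w == mate M' x) && slide_step (mate M) (mate M') x)%:R : R).
  apply: eq_bigr => w wM; have fw : mate M w = w by apply/eqP; rewrite -holesP.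
  rewrite -slide_stepP //; case: ifP => [xw|_]; last by rewrite eq_sym (negbTE MM').
  rewrite slide_proposal //=; congr (nat_of_bool _)%:R; apply/eqP/eqP => [->|<-].
    by rewrite mate_of ?slide_involutive.
  by rewrite mateM_of.
case: (boolP (slide_step _ _ _)) => [s|_]; last first.
  by rewrite big1 // => w _; rewrite andbF.
rewrite (bigD1 (mate M' x)) /=; last by rewrite holesP //; case/and5P: s.
by rewrite eqxx big1 ?addr0 // => w /andP[_ /negbTE->].
Qed.

Lemma card_perfect M : perfect M -> (#|M| * 2 = #|G|)%N.
Proof.
move=> /andP[hM /eqP h0]; case/andP: (hM) => _ /eqP tI.
have := cardsC (cover M); rewrite -/(holes M) h0 cards0 addn0 => <-.
rewrite -tI (eq_bigr (fun=> 2%N)) ?sum_nat_const //.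
by move=> e /(matchingE hM)[x [y [xy ->]]]; rewrite cards2 adj_neq.
Qed.

(** The right edge is removed with probability [1 / #|M|], which is [2 / #|G|]; it is added back
    when one of the two holes is drawn, with the same probability. *)
Lemma broder_perfect_near M M' : perfect M -> near M' ->
  broder R M M' = ((holes M' \in edges G) && (M == holes M' |: M'))%:R
    * 2 / #|G|%:R.
Proof.
move=> pM nM'; have hM : matching M by case/andP: pM.
have e2 : 2 / (#|M| * 2)%:R = #|M|%:R^-1 :> R.
  by rewrite natrM invfM mulrCA divff ?mulr1 // pnatr_eq0.
rewrite /broder pM /unif -(card_perfect pM) -mulrA e2; congr (_ / _).
set c := (_ \in _) && _.
transitivity (\sum_(e in M) ((e == holes M') && c)%:R : R).
  apply: eq_bigr => e eM; congr (nat_of_bool _)%:R; apply/eqP/andP.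
    move=> e'; have [_ he] := near_erase pM eM.
    rewrite /c e' he eqxx setD1K // eqxx andbT; split => //.
    by case/andP: hM => /fintype.subsetP sub _; exact: sub.
  case=> /eqP -> /andP[_ /eqP ->]; rewrite setU1K //.
  by apply: holes_notin; exact: near_neq0.
case: (boolP c) => [/andP[_ /eqP e]|_]; last by rewrite big1 // => w _; rewrite andbF.
rewrite (bigD1 (holes M')) /=; last by rewrite e setU11.
by rewrite eqxx big1 ?addr0 // => w /andP[_ /negbTE->].
Qed.

Lemma broder_near_perfect M M' : near M -> perfect M' ->
  broder R M M' = ((holes M \in edges G) && (M' == holes M |: M))%:R
    * 2 / #|G|%:R.
Proof.
move=> nM pM'; have [hM h2] := nearP nM.
have neq : M' == M = false.
  by apply: contraTF nM => /eqP <-; rewrite /near pM' andbF.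
rewrite /broder ifF; last by apply/negbTE; case/andP: nM.
rewrite /unif cardsT; congr (_ / _).
rewrite (eq_bigl predT); last by move=> x; rewrite inE.
rewrite (bigID (mem (holes M))) /= [X in _ + X]big1 ?addr0; last first.
  move=> x xM; rewrite /broder_near (negbTE xM) /unif big1 ?mul0r // => w wM.
  case: ifP => [xw|_]; last by rewrite neq.
  rewrite (_ : (_ == _) = false) //; apply: contraTF pM' => /eqP ->.
  by case/andP: (near_slide nM xM wM xw).
rewrite (eq_bigr (fun=> ((holes M \in edges G) && (M' == holes M |: M))%:R)).
  by rewrite sumr_const h2 mulr_natr.
move=> x xM; rewrite /broder_near xM; case: ifP => //=.
by rewrite neq.
Qed.

Lemma broder_perfect2 M M' : perfect M -> perfect M' -> broder R M M' = 0.
Proof.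
move=> pM pM'; rewrite /broder pM /unif big1 ?mul0r // => e eM.
rewrite (_ : (_ == _) = false) //; apply: contraTF pM' => /eqP ->.
by case: (near_erase pM eM) => /andP[].
Qed.

Lemma broder_sym M M' : in_Omega M -> in_Omega M' ->
  broder R M M' = broder R M' M.
Proof.
move=> hM hM'; have [->//|ne] := eqVneq M M'.
have [pM|pM] := boolP (perfect M); have [pM'|pM'] := boolP (perfect M').
- by rewrite !broder_perfect2.
- have nM' : near M' by rewrite /near hM'.
  by rewrite broder_perfect_near // broder_near_perfect.
- have nM : near M by rewrite /near hM.
  by rewrite broder_near_perfect // broder_perfect_near.
- have nM : near M by rewrite /near hM.
  have nM' : near M' by rewrite /near hM'.
  rewrite !broder_nearE // 1?eq_sym //.
  by under eq_bigr do rewrite slide_step_sym.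
Qed.

(** The three kinds of moves: a slide, the removal of an edge, and the addition of one, which is a
    removal read backwards. *)
Definition mate_step f f' := exists x,
  slide_step f f' x \/ (f x != x /\ f' = erase f x) \/ (f' x != x /\ f = erase f' x).

Lemma broder_step M M' : in_Omega M -> in_Omega M' -> M != M' ->
  broder R M M' != 0 -> mate_step (mate M) (mate M').
Proof.
have er N N' : in_Omega N' -> perfect N -> broder R N N' != 0 ->
    exists x, mate N x != x /\ mate N' = erase (mate N) x.
  move=> hN' pN; have hN : matching N by case/andP: pN.
  have [pN'|pN'] := boolP (perfect N'); first by rewrite broder_perfect2 ?eqxx.
  have nN' : near N' by rewrite /near hN'.
  rewrite broder_perfect_near //.
  case: (boolP (_ && _)) => [/andP[_ /eqP e]|]; last by rewrite !mul0r eqxx.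
  move=> _; have hin : holes N' \in N by rewrite e setU11.
  have eN' : N' = N :\ holes N'.
    by rewrite e setU1K // holes_notin ?near_neq0.
  have [x [y [xy hh]]] := matchingE hN hin.
  have fx : mate N x = y by apply: mate_eq; rewrite -?hh.
  exists x; rewrite fx eq_sym adj_neq //; split => //.
  rewrite eN' hh -fx erase_proposal // mate_of // erase_involutive //.
  exact: mate_involutive.
move=> hM hM' ne b.
have [pM|pM] := boolP (perfect M).
  by have [x hx] := er _ _ hM' pM b; exists x; right; left.
have [pM'|pM'] := boolP (perfect M').
  move: b; rewrite broder_sym // => b.
  by have [x hx] := er _ _ hM pM' b; exists x; right; right.
have nM : near M by rewrite /near hM.
have nM' : near M' by rewrite /near hM'.
move: b; rewrite broder_nearE //.
have [[x hx]|h] := pselect (exists x, slide_step (mate M) (mate M') x).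
  by move=> _; exists x; left.
rewrite big1 ?mul0r ?eqxx // => x _.
by rewrite (_ : slide_step _ _ _ = false) ?mul0r //; apply/negP => hx; apply: h; exists x.
Qed.

End Broder.

(** * Reversibility of chains of JSV type, and probabilities compared by counting *)

Section JSV.
Local Open Scope ring_scope.
Variables (R : realType) (G : graph) (w : state G -> R).
Hypothesis hw : jsv_weight w.
Hypothesis G0 : (0 < #|G|)%N.
Implicit Types M : state G.

Lemma weight_gt0 M : 0 < w M. Proof. exact: hw.1. Qed.

Lemma accept_itv M M' : 0 <= accept w M M' <= 1.
Proof.
rewrite /accept; apply/andP; split; last by rewrite ge_min lexx.
by rewrite le_min ler01 divr_ge0 // ltW ?weight_gt0.
Qed.

Lemma jsv_prob_ge0 M M' : 0 <= jsv_prob w M M'.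
Proof.
rewrite addr_ge0 // mulr_ge0 ?broder_ge0 //.
  by case/andP: (accept_itv M M').
rewrite sumr_ge0 // => N _; rewrite mulr_ge0 ?broder_ge0 // subr_ge0.
by case/andP: (accept_itv M N).
Qed.

Lemma jsv_prob_sum M : \sum_M' jsv_prob w M M' = 1.
Proof.
rewrite big_split /= -mulr_suml.
have -> : \sum_(i : state G) (i == M)%:R = 1 :> R.
  by rewrite (bigD1 M) //= eqxx big1 ?addr0 // => i /negbTE ->.
rewrite mul1r -big_split /= -[RHS](broder_sum R G0 (valP M)).
by apply: eq_bigr => N _; rewrite -mulrDr addrC subrK mulr1.
Qed.

Lemma total_gt0 M : 0 < \sum_N w N.
Proof.
rewrite (bigD1 M) //= ltr_wpDr ?weight_gt0 //.
by rewrite sumr_ge0 // => N _; rewrite ltW ?weight_gt0.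
Qed.

Lemma stationary_ge0 M : 0 <= stationary w M.
Proof. by rewrite divr_ge0 ?ltW ?weight_gt0 ?(total_gt0 M). Qed.

Lemma stationary_sum M : \sum_N stationary w N = 1.
Proof. by rewrite /stationary -mulr_suml divff // gt_eqF // (total_gt0 M). Qed.

(** The Metropolis rule over a symmetric proposal: [w N * accept w N N'] is the minimum of the two
    weights. *)
Lemma jsv_reversible M M' :
  stationary w M * jsv_prob w M M' = stationary w M' * jsv_prob w M' M.
Proof.
have [->//|ne] := eqVneq M M'.
rewrite /jsv_prob eq_sym (negbTE ne) !mul0r !addr0 (broder_sym R (valP M) (valP M')).
have minE N N' : w N * accept w N N' = Num.min (w N) (w N').
  rewrite /accept minr_pMr ?ltW ?weight_gt0 // mulr1 mulrCA divff ?mulr1 //.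
  by rewrite gt_eqF ?weight_gt0.
rewrite /stationary !(mulrAC _ (_^-1)) !(mulrCA (w _)) !minE.
by rewrite minC.
Qed.

Lemma jsv_prob_step M M' : M != M' -> jsv_prob w M M' != 0 ->
  mate_step (mate (val M)) (mate (val M')).
Proof.
move=> ne; rewrite /jsv_prob [M' == M]eq_sym (negbTE ne) mul0r addr0 => h.
apply: (@broder_step R _ _ _ (valP M) (valP M')); first by [].
by apply: contra h => /eqP ->; rewrite mul0r.
Qed.

Lemma jsv_bottleneck (A B : {set state G}) (a T : R) :
  (forall M M', M \in A -> M' \notin A ->
     mate_step (mate (val M)) (mate (val M')) -> M' \in B) ->
  0 < a -> a <= \sum_(M in A) stationary w M ->
  a <= \sum_(M in ~: A) stationary w M ->
  0 <= T -> T * \sum_(M in B) stationary w M < 4^-1 * a ->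
  (T%:E <= jsv_mixing_time w)%E.
Proof.
move=> AB a0 aA aC T0 TB.
have [M MA] : exists M, M \in A.
  apply/set0Pn; apply: contraTneq aA => ->; by rewrite big_set0 -ltNge.
apply: (bottleneck_mixing jsv_prob_ge0 jsv_prob_sum stationary_ge0
  (stationary_sum M) jsv_reversible (A := A) (B := B) _ a0) => //.
move=> N N' NA N'A /jsv_prob_step h; apply: (AB N) => //; apply: h.
by apply: contraNneq N'A => <-.
Qed.

(* Within a hole pattern the weights are constant, so comparing weights
   amounts to counting. *)
Lemma class_weight_le (k l : nat) (X Y : {set state G}) (h : {set G}) :
  (k * #|[set M in X | holes (val M) == h]| <=
   l * #|[set M in Y | holes (val M) == h]|)%N ->
  k%:R * \sum_(M in X | holes (val M) == h) stationary w M <=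
  l%:R * \sum_(M in Y | holes (val M) == h) stationary w M.
Proof.
move=> kl.
have sumE (Z : {set state G}) M0 : holes (val M0) = h ->
    \sum_(M in Z | holes (val M) == h) stationary w M =
    stationary w M0 * #|[set M in Z | holes (val M) == h]|%:R.
  move=> h0; rewrite mulr_natr -sumr_const; apply: eq_big => M.
    by rewrite inE.
  move=> /andP[_ /eqP hM]; congr (_ / _); apply: hw.2; by rewrite hM h0.
have [[M0 h0]|no] := pselect (exists M0 : state G, holes (val M0) = h).
  rewrite !(sumE _ M0) // !(mulrCA _ (stationary w M0)).
  by rewrite ler_wpM2l ?stationary_ge0 // -!natrM ler_nat.
by rewrite !big1 ?mulr0 // => M /andP[_ /eqP hM]; case: no; exists M.
Qed.

(** The comparison within each hole pattern is summed over all patterns, whose total probability is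
    1, so the bound holds for every admissible weight. *)
Lemma bottleneck_weight_le (k l : nat) (B : {set state G}) (M0 : state G) :
  (forall M, M \in B -> 
    (k * #|[set N in B | holes (val N) == holes (val M)]| <=
     l * #|[set N : state G | holes (val N) == holes (val M)]|)%N) ->
  k%:R * \sum_(M in B) stationary w M <= l%:R.
Proof.
move=> kl; rewrite -[leRHS]mulr1 -[X in _ <= _ * X](stationary_sum M0).
rewrite (partition_big (fun M : state G => holes (val M)) predT) //=.
rewrite [X in _ <= _ * X](partition_big (fun M : state G => holes (val M)) predT) //=.
rewrite !mulr_sumr; apply: ler_sum => h _.
have := @class_weight_le k l B setT h.
have -> : \sum_(M in [set: state G] | holes (val M) == h) stationary w M =
    \sum_(M : state G | holes (val M) == h) stationary w M.
  by apply: eq_bigl => M; rewrite inE.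
apply.
have [[M /andP[MB /eqP hM]]|no] :=
    pselect (exists M, (M \in B) && (holes (val M) == h)).
  have := kl M MB; rewrite hM => /leq_trans; apply.
  by rewrite leq_mul2l; apply/orP; right; apply: subset_leq_card;
    apply/fintype.subsetP => N; rewrite !inE.
rewrite (_ : [set M in B | _] = set0) ?cards0 ?muln0 //.
apply/setP => M; rewrite !inE; apply/negP => hM; apply: no; by exists M.
Qed.

(** All perfect matchings have the empty hole pattern and thus the same weight, so their
    probabilities compare like their numbers. *)
Lemma perfect_weight_ge (k : nat) (X : {set state G}) :
  {in X, forall M, perfect (val M)} ->
  (#|[set M : state G | perfect (val M)]| <= k * #|X|)%N ->
  stationary_perfect w <= k%:R * \sum_(M in X) stationary w M.
Proof.
move=> XP kX.
have perf0 M : perfect (val M) -> holes (val M) = set0.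
  by case/andP => _ /eqP.
have := @class_weight_le 1 k [set M : state G | perfect (val M)] X set0.
rewrite mul1n mul1r.
have e1 M : (M \in [set M : state G | perfect (val M)]) && (holes (val M) == set0) =
    perfect (val M).
  rewrite inE; case: (boolP (perfect _)) => //= /perf0 ->; by rewrite eqxx.
have e2 M : (M \in X) && (holes (val M) == set0) = (M \in X).
  by case: (boolP (M \in X)) => //= /XP/perf0 ->; rewrite eqxx.
rewrite (eq_bigl _ _ e1) (eq_bigl _ _ e2) -/(stationary_perfect w).
have -> : [set M in [set M : state G | perfect (val M)] | holes (val M) == set0]
   = [set M : state G | perfect (val M)] by apply/setP => M; rewrite inE e1 inE.
have -> : [set M in X | holes (val M) == set0] = X.
  by apply/setP => M; rewrite inE e2.
exact.
Qed.

End JSV.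

(** * Port patterns *)

(* Port [2c + e] is end [e] of chain [c]; chains 0, ..., 5 join the triangles
   01, 23, 02, 13, 03 and 12.  Throughout, [o] tells for each port whether it is
   matched outside its chain, and [h] lists the number of holes of each chain. *)
Definition triangle (i : nat) : nat :=
  nth 0 [:: 0; 1; 2; 3; 0; 2; 1; 3; 0; 3; 1; 2] i.

Definition both_out (o : seq bool) (c : nat) : bool :=
  nth false o c.*2 && nth false o c.*2.+1.

Definition one_out (o : seq bool) (c : nat) : bool :=
  nth false o c.*2 (+) nth false o c.*2.+1.

Definition same_ends (o o' : seq bool) (c : nat) : bool :=
  (nth false o c.*2 == nth false o' c.*2) &&
  (nth false o c.*2.+1 == nth false o' c.*2.+1).

Definition triangles_even (o : seq bool) : bool :=
  all (fun v => ~~ odd (count (fun i => (triangle i == v) && nth false o i) (iota 0 12)))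
    (iota 0 4).

Fixpoint bitseqs (n : nat) : seq (seq bool) :=
  if n is n'.+1 then
    [seq true :: s | s <- bitseqs n'] ++ [seq false :: s | s <- bitseqs n']
  else [:: [::]].

Lemma mem_bitseqs (s : seq bool) : s \in bitseqs (size s).
Proof.
elim: s => [|b s IH] //=; rewrite mem_cat; case: b; apply/orP; [left|right];
  exact: map_f.
Qed.

Definition patterns : seq (seq bool) := [seq o <- bitseqs 12 | triangles_even o].

Fixpoint natseqs (b n : nat) : seq (seq nat) :=
  if n is n'.+1 then flatten [seq [seq k :: s | s <- natseqs (b - k) n'] | k <- iota 0 b.+1]
  else [:: [::]].

Lemma mem_natseqs (b : nat) (s : seq nat) : sumn s <= b -> s \in natseqs b (size s).
Proof.
elim: s b => [|k s IH] b; first by [].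
rewrite [sumn _]/= => h; apply/(@flatten_mapP _ _ _ (iota 0 b.+1)); exists k.
  by rewrite mem_iota add0n ltnS (leq_trans (leq_addr _ _) h).
by apply: map_f; apply: IH; rewrite leq_subRL ?(leq_trans (leq_addr _ _) h).
Qed.

(* Chains have an even number of vertices. *)
Definition parities (o : seq bool) (h : seq nat) : bool :=
  all (fun c => odd (nth 0 h c) == one_out o c) (iota 0 6).

(* Each of these chains has at least 2^r matchings, independently of the others. *)
Definition free_chains (o : seq bool) (h : seq nat) : nat :=
  count (fun c => (nth 0 h c == 0) && both_out o c) (iota 0 6).

(* Keeping the ends of the chains with holes makes [o'] realizable with the same
   holes as [o]. *)
Definition improves (o o' : seq bool) (h : seq nat) : bool :=
  all (fun c => if nth 0 h c == 0 then ~~ one_out o' c else same_ends o o' c) (iota 0 6)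
  && (free_chains o h < free_chains o' h).

Definition suboptimal (o : seq bool) (h : seq nat) : bool :=
  has (fun o' => improves o o' h) patterns.

(* The chains with both ports matched inside are among the opposite chains 0
   and 1. *)
Definition inside (o : seq bool) : bool :=
  all (fun c => nth false o c.*2 || nth false o c.*2.+1) [:: 2; 3; 4; 5].

(* A move changes the mates of at most three vertices, one of which is a hole
   before or after the move and all ports among which lie in one triangle. *)
Definition pattern_step (o o' : seq bool) (h : seq nat) : bool :=
  has (fun v => all (fun i => (triangle i == v) || (nth false o i == nth false o' i))
    (iota 0 12)) (iota 0 4)
  && all (fun i => all (fun j =>
       [&& ~~ nth false o i, nth false o' i, nth false o j & ~~ nth false o' j]
         ==> (nth 0 h i./2 != 0)) (iota 0 12)) (iota 0 12).

Definition holes_ok (h : seq nat) : bool := (sumn h == 0) || (sumn h == 2).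

Definition configurations : seq (seq bool * seq nat) :=
  [seq s <- [seq (o, h) | o <- patterns, h <- [seq h <- natseqs 2 6 | holes_ok h]]
     | parities s.1 s.2].

(* Phrased with [filter], which branches lazily, rather than with boolean
   connectives, which call-by-value reduction evaluates in full. *)
Definition check_boundary : bool :=
  let outer := [seq s <- configurations | ~~ inside s.1] in
  let bad := [seq s <- outer | ~~ suboptimal s.1 s.2] in
  all (fun s => all (fun s' => ~~ pattern_step s.1 s'.1 s.2) bad)
    [seq s <- configurations | inside s.1].

(** An exhaustive search over port patterns and hole counts: a move out of the inner configurations
    can only reach a suboptimal one. *)
Lemma check_boundaryT : check_boundary.
Proof. by vm_compute. Qed.

(** A triangle has three ports, evenly many of them matched outside their chains, so a port matched
    outside has exactly one candidate for its mate. *)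
Definition partner (o : seq bool) (i : nat) : nat :=
  nth 0 [seq j <- iota 0 12 | [&& triangle j == triangle i, j != i & nth false o j]] 0.

Definition check_partner : bool :=
  all (fun o => all (fun i => nth false o i ==>
    let j := partner o i in
    [&& j < 12, nth false o j, j != i, triangle j == triangle i, j./2 != i./2,
        partner o j == i &
        all (fun k => [&& triangle k == triangle i, k != i & nth false o k] ==>
               (k == j)) (iota 0 12)]) (iota 0 12)) patterns.

Lemma check_partnerT : check_partner.
Proof. by vm_compute. Qed.

(** Each of the four triangles has at most two ports matched outside, eight in all, and a free chain
    uses two of them. *)
Definition check_free : bool :=
  all (fun o => all (fun c => ~~ one_out o c) (iota 0 6) ==>
    (free_chains o (nseq 6 0) <= 4)) patterns.

Lemma check_freeT : check_free.
Proof. by vm_compute. Qed.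

Definition check_shape : bool := all (fun o => size o == 12) patterns.

Lemma check_shapeT : check_shape.
Proof. by vm_compute. Qed.

(** * Chains *)

Lemma even_card_involution (T : finType) (X : {set T}) (f : T -> T) :
  {in X, forall x, [/\ f x \in X, f x != x & f (f x) = x]} -> ~~ odd #|X|.
Proof.
have [n] := ubnP #|X|; elim: n X => // n IH X /ltnSE hn hX.
have [->|[x xX]] := set_0Vmem X; first by rewrite cards0.
have [fX fx ffx] := hX x xX.
have c2 : #|X| = #|X :\: [set x; f x]|.+2.
  rewrite -(cardsID [set x; f x] X) (setIidPr _) ?cards2 1?eq_sym ?fx //.
  by apply/fintype.subsetP => y /set2P[] ->.
rewrite c2 /= negbK; apply: IH; first by rewrite c2 in hn; apply: ltnW.
move=> y; rewrite in_setD in_set2 negb_or => /andP[/andP[yx yfx] yX].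
have [fyX fy ffy] := hX y yX; split=> //; rewrite in_setD in_set2 negb_or fyX andbT.
apply/andP; split; first by apply: contraNneq yfx => <-; rewrite ffy.
by apply: contraNneq yx => e; rewrite -ffy e ffx.
Qed.

(** * Half graphs and their unique perfect matching *)

Section HalfGraph.
Variable m : nat.

(* [(i, true)] and [(j, false)] are the two sides of a half graph. *)
Definition hvert : finType := ('I_m.+1 * bool)%type.

Definition hadj (p q : hvert) : bool :=
  if p.2 then ~~ q.2 && (q.1 <= p.1) else q.2 && (p.1 <= q.1).

Lemma hadj_sym p q : hadj p q = hadj q p.
Proof. by case: p q => [i []] [j []]; rewrite /hadj. Qed.

Lemma hadj_irr p : hadj p p = false.
Proof. by case: p => i []. Qed.

(** The two vertices of degree one in the half graph, one on each side. *)
Definition port (e : bool) : hvert := if e then (ord_max, false) else (ord0, true).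

Definition is_port (p : hvert) : bool := p == port (~~ p.2).

Lemma is_portP p : reflect (exists e, p = port e) (is_port p).
Proof.
apply: (iffP eqP) => [->|[[] ->]]; rewrite ?eqxx //.
by exists (~~ p.2).
Qed.

Lemma port_side e : (port e).2 = ~~ e.
Proof. by case: e. Qed.

Lemma port_inj : injective port.
Proof. by move=> [] [] // [] //. Qed.

Lemma is_port_port e : is_port (port e).
Proof. by apply/is_portP; exists e. Qed.

(* [e0] and [e1] tell which ports are matched outside the half graph; such a port
   is a fixed point of the involution, just like a hole. *)
Definition exposed (e0 e1 : bool) (h : {set hvert}) (p : hvert) : bool :=
  [|| p \in h, (p == port false) && e0 | (p == port true) && e1].

Definition local (e0 e1 : bool) (h : {set hvert}) : {set {ffun hvert -> hvert}} :=
  [set g : {ffun hvert -> hvert} | [forall p, [&& g (g p) == p,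
     (g p == p) || hadj p (g p) & (g p == p) == exposed e0 e1 h p]]].

Lemma localP e0 e1 h (g : {ffun hvert -> hvert}) : reflect
  [/\ forall p, g (g p) = p, forall p, g p != p -> hadj p (g p) &
      forall p, (g p == p) = exposed e0 e1 h p] (g \in local e0 e1 h).
Proof.
rewrite inE; apply: (iffP forallP) => [H|[H1 H2 H3] p].
  split=> p; have /and3P[/eqP h1 h2 /eqP h3] := H p => //.
  by case/orP: h2 => [->|].
rewrite H1 eqxx /= H3 eqxx andbT -H3.
by case: (boolP (g p == p)) => //= /H2.
Qed.

(** With all vertices to be matched, [(0, true)] must take its only neighbour [(0, false)], then
    [(1, true)] its only neighbour left, and so on. *)
Lemma local_full : #|local false false set0| = 1.
Proof.
pose g0 : {ffun hvert -> hvert} := [ffun p => (p.1, ~~ p.2)].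
suff -> : local false false set0 = [set g0] by rewrite cards1.
apply/setP => g; rewrite in_set1; apply/localP/eqP => [[g1 g2 g3]|->]; last first.
  split=> [[i b]|[i b]|[i b]].
  - by rewrite !ffunE /= negbK.
  - by rewrite !ffunE /hadj /= => _; case: b => /=.
  - rewrite !ffunE /exposed inE !andbF /=; apply/negbTE/eqP => -[].
    by case: b.
have gne p : g p != p by rewrite g3 /exposed inE !andbF.
have up n : forall i : 'I_m.+1, i <= n -> g (i, true) = (i, false).
  elim: n => [|n IH] i ni.
    have := g2 _ (gne (i, true)); case e : (g (i, true)) => [j b].
    rewrite /hadj /= => /andP[/negbTE -> ji]; congr (_, _).
    by apply: val_inj; apply/eqP; rewrite /= eqn_leq ji; lia.
  have := g2 _ (gne (i, true)); case e : (g (i, true)) => [j b].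
  rewrite /hadj /= => /andP[/negbTE bF ji]; rewrite bF in e *; congr (_, _).
  apply: val_inj; apply/eqP; rewrite /= eqn_leq ji leqNgt; apply/negP => lt.
  have := IH j (leq_trans lt ni); rewrite -[in LHS](g1 (j, true)) => ej.
  have : g (j, true) = (j, false) by apply: IH; rewrite -ltnS (leq_trans lt ni).
  move=> ej'; have := g1 (j, true); rewrite ej' => ej2.
  have := g1 (i, true); rewrite e ej2 => -[] ij.
  by rewrite ij ltnn in lt.
apply/ffunP => -[i b]; rewrite ffunE; case: b; first exact: (up i).
by have := g1 (i, true); rewrite (up i).
Qed.

End HalfGraph.

(** * Half graphs without their ports have exponentially many perfect matchings *)

Section Free.
Variable r : nat.
Notation m := r.*2.

(** Transposes [2k] and [2k + 1] for every pair [k] selected by [b]. *)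
Definition flip (b : nat -> bool) (i : nat) : nat :=
  if b i./2 then (if odd i then i.-1 else i.+1) else i.

Lemma flip_lt b i : i < m -> flip b i < m.
Proof. by rewrite /flip; case: (b _) => //; case: ifP => h; lia. Qed.

Lemma flip_half b i : (flip b i)./2 = i./2.
Proof. by rewrite /flip; case: (b _) => //; case: ifP => h; lia. Qed.

Lemma flipK b i : flip b (flip b i) = i.
Proof.
rewrite {1}/flip flip_half /flip; case: (b _) => //.
by case: (boolP (odd i)) => h; case: ifP => h'; lia.
Qed.

(** This bound makes [(i.+1, true)] and [(flip b i, false)] adjacent. *)
Lemma flip_le b i : flip b i <= i.+1.
Proof. by rewrite /flip; case: (b _) => //; case: ifP => h; lia. Qed.

(* With both ports removed, [(i.+1, true)] may be matched to [(flip b i, false)]. *)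
Definition flip_mate b : {ffun hvert m -> hvert m} :=
  [ffun p : hvert m => if is_port p then p
             else if p.2 then (inord (flip b p.1.-1), false)
             else (inord (flip b p.1).+1, true)].

Lemma flip_mate_true b (i : 'I_m.+1) : i != ord0 ->
  exists2 j : 'I_m.+1, flip_mate b (i, true) = (j, false) & j = flip b i.-1 :> nat.
Proof.
move=> i0; exists (inord (flip b i.-1)).
  by rewrite ffunE /is_port /= xpair_eqE (negbTE i0).
rewrite inordK // ltnS ltnW // flip_lt //.
by have := ltn_ord i; move: i0; rewrite -val_eqE /=; lia.
Qed.

Lemma flip_mate_false b (j : 'I_m.+1) : j != ord_max ->
  exists2 i : 'I_m.+1, flip_mate b (j, false) = (i, true) & i = (flip b j).+1 :> nat.
Proof.
move=> jm; exists (inord (flip b j).+1).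
  by rewrite ffunE /is_port /= xpair_eqE (negbTE jm).
rewrite inordK // ltnS flip_lt //.
by have := ltn_ord j; move: jm; rewrite -val_eqE /=; lia.
Qed.

Lemma flip_mate_port b e : flip_mate b (port m e) = port m e.
Proof. by rewrite ffunE is_port_port. Qed.

Lemma flip_mate_local b : flip_mate b \in local true true set0.
Proof.
have cases (p : hvert m) : (exists e, p = port m e) \/
   (exists2 i : 'I_m.+1, i != ord0 & p = (i, true)) \/
   (exists2 j : 'I_m.+1, j != ord_max & p = (j, false)).
  case: p => i []; first have [->|h] := eqVneq i ord0.
  - by left; exists false.
  - by right; left; exists i.
  - have [->|h] := eqVneq i ord_max; first by left; exists true.
    by right; right; exists i.
apply/localP; split=> p; have [[e ->]|[[i h ->]|[i h ->]]] := cases p.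
- by rewrite !flip_mate_port.
- have [j -> ej] := flip_mate_true b h.
  have jm : j != ord_max.
    rewrite -val_eqE /= ej neq_ltn flip_lt //.
    by have := ltn_ord i; move: h; rewrite -val_eqE /=; lia.
  have [k -> ek] := flip_mate_false b jm; congr (_, _).
  apply: val_inj; rewrite /= ek ej flipK.
  by move: h; rewrite -val_eqE /=; lia.
- have [j -> ej] := flip_mate_false b h.
  have j0 : j != ord0 by rewrite -val_eqE /= ej.
  have [k -> ek] := flip_mate_true b j0; congr (_, _).
  by apply: val_inj; rewrite /= ek ej flipK.
- by rewrite flip_mate_port eqxx.
- have [j -> ej] := flip_mate_true b h; rewrite /hadj /= => _.
  rewrite ej (leq_trans (flip_le _ _)) //.
  by move: h; rewrite -val_eqE /=; lia.
- have [j -> ej] := flip_mate_false b h; rewrite /hadj /= => _.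
  (* On this side, adjacency is the same bound taken at the index [flip b i]. *)
  by rewrite ej -[X in X <= _](flipK b) flip_le.
- by rewrite flip_mate_port eqxx /exposed; case: e; rewrite eqxx ?orbT.
- have [j -> ej] := flip_mate_true b h.
  by rewrite /exposed inE !xpair_eqE (negbTE h) /= !andbF.
- have [j -> ej] := flip_mate_false b h.
  by rewrite /exposed inE !xpair_eqE (negbTE h) /= !andbF.
Qed.

(** The [r] pairs of indices can be flipped independently, and the mate of [(2i, false)] reveals
    whether pair [i] is flipped. *)
Lemma card_free : 2 ^ r <= #|local true true (set0 : {set hvert m})|.
Proof.
pose bit (b : {ffun 'I_r -> bool}) k := [exists i : 'I_r, (val i == k) && b i].
have bitE b (i : 'I_r) : bit b i = b i.
  apply/existsP/idP => [[j /andP[/eqP/val_inj -> //]]|bi].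
  by exists i; rewrite eqxx.
have <- : #|[set: {ffun 'I_r -> bool}]| = 2 ^ r.
  by rewrite cardsT card_ffun card_bool card_ord.
rewrite -(card_in_imset (f := fun b => flip_mate (bit b)) (D := setT)); last first.
  move=> b b' _ _ e; apply/ffunP => i.
  have im : i.*2 < m by have := ltn_ord i; lia.
  have jm : (Ordinal (ltnW im : i.*2 < m.+1)) != ord_max.
    by rewrite -val_eqE /= neq_ltn im.
  have [k ek1 ek] := flip_mate_false (bit b) jm.
  have [k' ek1' ek'] := flip_mate_false (bit b') jm.
  move: ek1; rewrite e ek1' => -[kk]; move: ek'; rewrite kk ek => -[].
  rewrite /flip /= doubleK odd_double !bitE.
  by case: (b i); case: (b' i) => //; lia.
apply: subset_leq_card; apply/fintype.subsetP => _ /imsetP[b _ ->].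
exact: flip_mate_local.
Qed.

End Free.

(** * The graph and its matchings *)

Section Gadget.
Variable m : nat.

Definition vert : finType := ('I_6 * hvert m)%type.

(** For a port, the side tells the end of the chain. For any other vertex this is just some index
    below 12. *)
Definition port_index (x : vert) : nat := x.1.*2 + ~~ x.2.2.

Definition gadj (x y : vert) : bool :=
  if x.1 == y.1 then hadj x.2 y.2
  else [&& is_port x.2, is_port y.2 &
           triangle (port_index x) == triangle (port_index y)].

Lemma gadj_sym : symmetric gadj.
Proof.
move=> x y; rewrite /gadj eq_sym; case: ifP => _; first exact: hadj_sym.
by rewrite [triangle _ == _]eq_sym andbCA.
Qed.

Lemma gadj_irr : irreflexive gadj.
Proof. by move=> x; rewrite /gadj eqxx hadj_irr. Qed.

Definition gadget : graph := Graph gadj_sym gadj_irr.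

Definition prt (i : nat) : vert := (inord i./2, port m (odd i)).

Lemma prtE (c : 'I_6) (e : bool) : prt (c.*2 + e) = (c, port m e).
Proof.
rewrite /prt oddD odd_double /= oddb; congr (_, _).
by rewrite halfD odd_double doubleK /= add0n (_ : e./2 = 0) ?addn0 ?inord_val //; case: e.
Qed.

Lemma port_indexK x : is_port x.2 -> prt (port_index x) = x.
Proof.
by case: x => c p /= /eqP pE; rewrite /port_index prtE /= -pE.
Qed.

Lemma port_index_lt x : port_index x < 12.
Proof.
by rewrite /port_index; case: x => c [j b] /=; have := ltn_ord c; case: b => /=; lia.
Qed.

Lemma prtK i : i < 12 -> port_index (prt i) = i.
Proof.
move=> i12; rewrite /port_index /= port_side negbK inordK; last by lia.
by lia.
Qed.

Lemma prt_port i : is_port (prt i).2. Proof. exact: is_port_port. Qed.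

Lemma prt_chain i : i < 12 -> (prt i).1 = i./2 :> nat.
Proof. by move=> i12; rewrite /= inordK; lia. Qed.

Definition outs (f : vert -> vert) : 12.-tuple bool :=
  [tuple (f (prt i)).1 != (prt i).1 | i < 12].

Lemma outsE f i : i < 12 -> nth false (outs f) i = ((f (prt i)).1 != (prt i).1).
Proof. by move=> h; rewrite -[i]/(val (Ordinal h)) -tnth_nth tnth_mktuple. Qed.

Lemma outs_chain f (c : 'I_6) (e : bool) :
  nth false (outs f) (c.*2 + e) = ((f (c, port m e)).1 != c).
Proof.
by rewrite outsE ?prtE //; have := ltn_ord c; case: e; lia.
Qed.

Definition hole_counts (h : {set vert}) : seq nat :=
  mkseq (fun c => #|[set x in h | x.1 == c :> nat]|) 6.

Section Mate.
Variable f : {ffun vert -> vert}.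
Hypothesis hf : @involutive_matching gadget f.
Let K := @invK gadget f hf.

Lemma mate_out x : (f x).1 != x.1 ->
  [/\ is_port x.2, is_port (f x).2 &
      triangle (port_index x) = triangle (port_index (f x))].
Proof.
move=> ne; have : f x != x by apply: contraNneq ne => ->.
move/(@inv_adj gadget f hf); rewrite /= /gadj eq_sym (negbTE ne).
by case/and3P => ? ? /eqP.
Qed.

Lemma mate_out_prt i : i < 12 -> nth false (outs f) i ->
  exists j, [/\ j < 12, f (prt i) = prt j, triangle j = triangle i, j != i
                & nth false (outs f) j].
Proof.
move=> i12; rewrite outsE // => ne; have [_ p2 t] := mate_out ne.
exists (port_index (f (prt i))); have lt := port_index_lt (f (prt i)).
split; rewrite ?port_indexK -?t ?prtK //; last first.
  by rewrite outsE // port_indexK // K eq_sym.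
by apply: contraNneq ne => {2}<-; rewrite port_indexK.
Qed.

(** The matching itself pairs off the ports of a triangle that are matched outside, since edges
    between chains stay in a triangle. *)
Lemma outs_triangles : triangles_even (outs f).
Proof.
apply/allP => v _; set a := (fun i => _).
have -> : count a (iota 0 12) = #|[set i : 'I_12 | a i]|.
  rewrite -sum1_count -[iota 0 12]/(index_iota 0 12) big_mkord sum1dep_card.
  by [].
apply: (@even_card_involution 'I_12 _ (fun i : 'I_12 => inord (port_index (f (prt i))))) => i.
rewrite inE => /andP[tv oi].
have [j [j12 fj tj ji oj]] := mate_out_prt (ltn_ord i) oi.
rewrite fj prtK //; split.
- by rewrite inE /a inordK // tj tv oj.
- by apply: contraNneq ji => <-; rewrite inordK.
- by rewrite inordK // -fj K prtK // inord_val.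
Qed.

Lemma outs_patterns : tval (outs f) \in patterns.
Proof.
rewrite mem_filter outs_triangles /=.
by have := mem_bitseqs (outs f); rewrite size_tuple.
Qed.

(** A chain has evenly many vertices, and they split into those matched inside it, again evenly
    many, the ports matched outside, and the holes. *)
Lemma outs_parities : parities (outs f) (hole_counts [set x | f x == x]).
Proof.
apply/allP => k; rewrite mem_iota add0n => /andP[_ k6].
rewrite nth_mkseq //.
pose c := Ordinal k6; pose C := [set x : vert | x.1 == c].
have cC : ~~ odd #|C|.
  apply: (@even_card_involution vert _ (fun x : vert => (x.1, (x.2.1, ~~ x.2.2)))) => x.
  rewrite !inE => /eqP xc; split; rewrite ?xc //.
    by case: x {xc} => d [i b]; apply/eqP => -[]; case: b.
  by case: x xc => d [i b] /= ->; rewrite negbK.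
pose X := [set x in C | (f x != x) && ((f x).1 == c)].
have cX : ~~ odd #|X|.
  apply: (@even_card_involution vert _ f) => x; rewrite !inE => /and3P[xc fx fc].
  by rewrite K fc eq_sym fx xc.
pose O := [set x in C | (f x).1 != c].
have cO : odd #|O| = one_out (outs f) k.
  have -> : O = [set (c, port m e) | e in [set e | (f (c, port m e)).1 != c]].
    apply/setP => x; apply/idP/imsetP => [|[e]]; last first.
      by rewrite inE => h ->; rewrite !inE eqxx.
    rewrite !inE => /andP[/eqP xc fx]; rewrite -xc in fx *.
    have [/is_portP[e pe] _ _] := mate_out fx.
    by exists e; rewrite ?inE -?pe -surjective_pairing.
  rewrite card_imset; last by move=> e e' [] /port_inj.
  rewrite -sum1_card big_mkcond big_bool /= !inE /one_out.
  have := outs_chain f c true; have := outs_chain f c false.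
  rewrite addn0 addn1 /= => -> ->.
  by case: (_ != _); case: (_ != _).
set H := [set x in _ | _].
have : #|C| = #|X| + #|O| + #|H|.
  rewrite -(cardsID O C) -addnA addnCA (setIidPr _); last first.
    by apply/fintype.subsetP => x; rewrite inE => /andP[].
  congr (_ + _); rewrite -(cardsID X (C :\: O)) (setIidPr _); last first.
    by apply/fintype.subsetP => x; rewrite !inE => /and3P[-> _ ->].
  congr (_ + _); apply: eq_card => x; rewrite !inE -val_eqE /=.
  have [xc|_] := eqVneq (x.1 : nat) k; rewrite ?andbF // !andbT.
  have [->|_] /= := eqVneq (f x) x; first by rewrite -val_eqE /= xc eqxx.
  by case: eqVneq.
move=> e; move: cC; rewrite e !oddD (negbTE cX) cO.
by case: (one_out _ _); case: (odd _).
Qed.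

End Mate.

(** * Factorization of matchings over the chains *)

Definition chain_holes (h : {set vert}) (c : 'I_6) : {set hvert m} :=
  [set p | (c, p) \in h].

Lemma hole_counts0 h (c : 'I_6) :
  (nth 0 (hole_counts h) c == 0) = (chain_holes h c == set0).
Proof.
rewrite nth_mkseq // cards_eq0; apply/eqP/eqP => /setP e; apply/setP => x.
  by have := e (c, x); rewrite !inE eqxx andbT.
rewrite !inE; apply/negbTE/negP => /andP[xh /eqP /val_inj xc].
by have := e x.2; rewrite !inE -xc -surjective_pairing xh.
Qed.

Definition local_class (o : seq bool) (h : {set vert}) (c : 'I_6) :=
  local (nth false o c.*2) (nth false o c.*2.+1) (chain_holes h c).

Definition class (o : 12.-tuple bool) (h : {set vert}) : {set {ffun vert -> vert}} :=
  [set f : {ffun vert -> vert} |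
    [&& @involutive_matching gadget f, [set x | f x == x] == h & outs f == o]].

Lemma classP o h (f : {ffun vert -> vert}) : reflect
  [/\ @involutive_matching gadget f, [set x | f x == x] = h & outs f = o]
  (f \in class o h).
Proof.
by rewrite inE; apply: (iffP and3P) => -[? /eqP ? /eqP ?]; split=> //; apply/eqP.
Qed.

(** A vertex matched to another chain becomes a fixed point, in accordance with [exposed]. *)
Definition restrict (f : {ffun vert -> vert}) : {ffun 'I_6 -> {ffun hvert m -> hvert m}} :=
  [ffun c : 'I_6 => [ffun p => if (f (c, p)).1 == c then (f (c, p)).2 else p]].

Lemma restrict_local o h f : f \in class o h ->
  restrict f \in family (fun c => mem (local_class o h c)).
Proof.
case/classP => hf <- <-; have K := @invK gadget f hf.
have rE c p : restrict f c p = if (f (c, p)).1 == c then (f (c, p)).2 else p.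
  by rewrite !ffunE.
apply/familyP => c; apply/localP; split=> p; rewrite (rE c p).
- case: eqP => [e|/eqP /negbTE ne]; rewrite rE ?ne //.
  have fe : f (c, p) = (c, (f (c, p)).2) by case: (f (c, p)) e => ? ? /= ->.
  by rewrite -fe K eqxx.
- case: ((f (c, p)).1 =P c) => [e ne|_]; last by rewrite eqxx.
  have fe : f (c, p) = (c, (f (c, p)).2) by case: (f (c, p)) e => ? ? /= ->.
  have : f (c, p) != (c, p) by rewrite fe xpair_eqE eqxx.
  by move/(@inv_adj gadget f hf); rewrite /= /gadj fe /= eqxx.
have o0 := outs_chain f c false; have o1 := outs_chain f c true.
rewrite addn0 in o0; rewrite addn1 in o1; rewrite /exposed !inE o0 o1.
case: (eqVneq (f (c, p)).1 c) => e.
  have fe : f (c, p) = (c, (f (c, p)).2) by case: (f (c, p)) e => ? ? /= ->.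
  have nb b : (p == port m b) && ((f (c, port m b)).1 != c) = false.
    by case: (p =P port m b) => //= <-; rewrite e eqxx.
  by rewrite !nb !orbF {2}fe xpair_eqE eqxx.
rewrite eqxx; apply/esym.
have [/is_portP[b /= pb] _ _] := mate_out hf e.
by move: e; rewrite pb; case: b {pb} => ->; rewrite ?eqxx ?andbT ?orbT.
Qed.

Lemma partnerP (o : seq bool) i : o \in patterns -> i < 12 -> nth false o i ->
  let j := partner o i in
  [/\ j < 12, nth false o j, triangle j = triangle i, j./2 != i./2 & partner o j = i]
  /\ forall k, k < 12 -> triangle k = triangle i -> k != i -> nth false o k -> k = j.
Proof.
move=> oP i12 oi /=.
have := allP (allP check_partnerT _ oP) i.
rewrite mem_iota add0n i12 oi => /(_ isT) /implyP/(_ isT).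
case/and5P => j12 oj _ /eqP tj /and3P[jh /eqP pj /allP u]; split=> // k k12 tk ki ok.
by have := u k; rewrite mem_iota add0n k12 tk eqxx ki ok => /(_ isT) /eqP.
Qed.

Lemma mate_partner f i : @involutive_matching gadget f -> i < 12 ->
  nth false (outs f) i -> f (prt i) = prt (partner (outs f) i).
Proof.
move=> hf i12 oi; have [j [j12 -> tj ji oj]] := mate_out_prt hf i12 oi.
have [_ u] := partnerP (outs_patterns hf) i12 oi; congr prt; exact: u.
Qed.

(** The restriction records the edges inside the chains; those between chains are determined by the
    port pattern through [partner]. *)
Lemma restrict_inj o h : {in class o h &, injective restrict}.
Proof.
move=> f f' /classP[hf _ of_] /classP[hf' _ of'] e.
have oo : outs f = outs f' by rewrite of_ of'.
apply/ffunP => -[c p].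
have chainE (g : {ffun vert -> vert}) : @involutive_matching gadget g -> (g (c, p)).1 != c ->
    exists2 i, i < 12 & (c, p) = prt i /\ nth false (outs g) i.
  move=> hg gc; have [pp _ _] := mate_out hg gc.
  exists (port_index (c, p)); first exact: port_index_lt.
  by rewrite outsE ?port_index_lt // port_indexK.
have [fc|fc] := eqVneq (f (c, p)).1 c; last first.
  have [i i12 [-> oi]] := chainE _ hf fc.
  by rewrite (mate_partner hf i12 oi) (mate_partner hf' i12) -?oo.
have [fc'|fc'] := eqVneq (f' (c, p)).1 c; last first.
  have [i i12 [-> oi]] := chainE _ hf' fc'.
  by rewrite (mate_partner hf' i12 oi) (mate_partner hf i12) ?oo.
have /ffunP/(_ p) := congr1 (fun g : {ffun 'I_6 -> _} => g c) e.
rewrite !ffunE fc fc' eqxx => e2.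
by rewrite [LHS]surjective_pairing [RHS]surjective_pairing fc fc' e2.
Qed.

Lemma card_familyE (F : 'I_6 -> {set {ffun hvert m -> hvert m}}) :
  #|family (fun c => mem (F c))| = \prod_c #|F c|.
Proof.
by rewrite card_family foldrE big_image.
Qed.

Lemma card_class_le o h : #|class o h| <= \prod_c #|local_class o h c|.
Proof.
rewrite -card_familyE -(card_in_imset (@restrict_inj o h)).
apply: subset_leq_card; apply/fintype.subsetP => _ /imsetP[f fc ->].
exact: restrict_local.
Qed.

(** The converse of [restrict]: ports marked by [o] are joined to their partners, and all other
    vertices follow the matchings of the chains. *)
Definition glue (o : seq bool) (g : {ffun 'I_6 -> {ffun hvert m -> hvert m}}) :
    {ffun vert -> vert} :=
  [ffun x : vert => if is_port x.2 && nth false o (port_index x)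
     then prt (partner o (port_index x)) else (x.1, g x.1 x.2)].

Section Glue.
Variables (o : 12.-tuple bool) (h : {set vert}).
Hypothesis oP : tval o \in patterns.
Hypothesis oh : forall i, i < 12 -> nth false o i -> prt i \notin h.

Lemma exposedE (c : 'I_6) (p : hvert m) :
  exposed (nth false o c.*2) (nth false o c.*2.+1) (chain_holes h c) p =
  ((c, p) \in h) || (is_port p && nth false o (port_index (c, p))).
Proof.
rewrite /exposed inE; congr (_ || _); rewrite /is_port /port_index /=.
case: p => i [] /=; rewrite ?addn0 ?addn1 !xpair_eqE /= ?andbF ?andbT /= ?orbF //.
Qed.

Lemma glue_class g : g \in family (fun c => mem (local_class o h c)) ->
  glue o g \in class o h.
Proof.
move=> /familyP gF.
have g1 c p : g c (g c p) = p by have /localP[] := gF c.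
have g2 c p : g c p != p -> hadj p (g c p) by have /localP[_ H _] := gF c; exact: H.
have g3 c p : (g c p == p) = ((c, p) \in h) || (is_port p && nth false o (port_index (c, p))).
  by have /localP[_ _ ->] := gF c; rewrite exposedE.
have outp x : is_port x.2 -> nth false o (port_index x) ->
    [/\ partner o (port_index x) < 12,
     glue o g x = prt (partner o (port_index x)) & (glue o g x).1 != x.1].
  move=> px ox; have [[j12 _ _ jh _] _] := partnerP oP (port_index_lt x) ox.
  have e : glue o g x = prt (partner o (port_index x)) by rewrite ffunE px ox.
  split=> //; rewrite e -val_eqE [val _]prt_chain //.
  by rewrite -{2}(port_indexK px) [val _]prt_chain ?port_index_lt.
have inp x : ~~ (is_port x.2 && nth false o (port_index x)) ->
    glue o g x = (x.1, g x.1 x.2) by move=> nx; rewrite ffunE (negbTE nx).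
(* A vertex matched inside its chain is never matched to a port marked by [o], because [g] fixes
   these ports. *)
have instay x : ~~ (is_port x.2 && nth false o (port_index x)) ->
    ~~ (is_port (g x.1 x.2) && nth false o (port_index (x.1, g x.1 x.2))).
  case: x => c p /= nx; apply: contra nx => nx.
  have : g c (g c p) == g c p by rewrite g3 nx orbT.
  by rewrite g1 => /eqP e; rewrite e.
have fixE x : (glue o g x == x) = (x \in h).
  have [/andP[px ox]|nx] := boolP (is_port x.2 && nth false o (port_index x)).
    have [_ _ ne] := outp x px ox.
    have := oh (port_index_lt x) ox; rewrite port_indexK // => /negbTE ->.
    by apply: contraNF ne => /eqP ->.
  by rewrite inp //; case: x nx => c p /= nx; rewrite xpair_eqE eqxx g3 (negbTE nx) orbF.
apply/classP; split.
- apply/forallP => x.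
  have [/andP[px ox]|nx] := boolP (is_port x.2 && nth false o (port_index x)).
    have [[j12 oj tj jh pj] _] := partnerP oP (port_index_lt x) ox.
    have [_ e ne] := outp x px ox.
    rewrite {1}e ffunE prt_port prtK // oj /= pj port_indexK // eqxx /=.
    by rewrite eq_sym in ne; rewrite /= /gadj (negbTE ne) px e prt_port prtK // tj eqxx orbT.
  rewrite (inp x nx) (inp (_, _) (instay x nx)) /=.
  case: x nx => c p /= nx; rewrite g1 eqxx xpair_eqE eqxx /=.
  by case: (eqVneq (g c p) p) => //= /g2; rewrite /gadj /= eqxx.
- by apply/setP => x; rewrite inE fixE.
- apply/val_inj/(@eq_from_nth _ false); rewrite ?size_tuple // => i i12.
  rewrite outsE //; have [oi|noi] := boolP (nth false o i).
    by have [|_ _ ->] := outp (prt i) (prt_port i); rewrite ?prtK.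
  by rewrite inp /= ?eqxx // prtK // (negbTE noi) andbF.
Qed.

Lemma glue_inj : {in family (fun c => mem (local_class o h c)) &, injective (glue o)}.
Proof.
move=> g g' /familyP gF /familyP gF' e; apply/ffunP => c; apply/ffunP => p.
have [np|np] := boolP (is_port p && nth false o (port_index (c, p))).
  have fixp (k : {ffun 'I_6 -> {ffun hvert m -> hvert m}}) :
      k c \in mem (local_class o h c) -> k c p = p.
    by move=> /localP[_ _ H]; apply/eqP; rewrite H exposedE np orbT.
  by rewrite !fixp.
have /ffunP/(_ (c, p)) := e.
by rewrite !ffunE /= (negbTE np) => -[].
Qed.

(** With [card_class_le] this shows that matchings with given holes and port pattern amount to
    independent choices in the six chains. *)
Lemma card_class_ge : \prod_c #|local_class o h c| <= #|class o h|.
Proof.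
rewrite -card_familyE -(card_in_imset glue_inj).
apply: subset_leq_card; apply/fintype.subsetP => _ /imsetP[g gF ->].
exact: glue_class.
Qed.

End Glue.

End Gadget.

(** * Counting states by hole pattern and port pattern *)

Section Counting.
Variable r : nat.
Notation m := r.*2.
Notation G := (gadget m).
Let U := #|local true true (set0 : {set hvert m})|.

Lemma count_iota6 (a : pred nat) : count a (iota 0 6) = \sum_(c < 6) a c.
Proof.
rewrite -sum1_count -[iota 0 6]/(index_iota 0 6) big_mkord big_mkcond.
by apply: eq_bigr => c _; case: (a c).
Qed.

(** By the parity assumption a chain without holes is either full, with one matching, or free, with
    [U] matchings. *)
Lemma prod_local (o : seq bool) (h : {set vert m}) :
  (forall c : 'I_6, nth 0 (hole_counts h) c == 0 -> ~~ one_out o c) ->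
  \prod_c #|local_class o h c| =
  (\prod_(c < 6) if nth 0 (hole_counts h) c == 0 then 1 else #|local_class o h c|) *
  U ^ free_chains o (hole_counts h).
Proof.
move=> oh; rewrite /free_chains count_iota6 expn_sum -big_split /=.
apply: eq_bigr => c _; case: (boolP (_ == 0)) => [c0|_] /=; last by rewrite muln1.
rewrite mul1n /local_class; have := oh c c0; rewrite hole_counts0 in c0.
rewrite (eqP c0) /one_out /both_out.
by case: (nth _ _ _); case: (nth _ _ _) => //= _; rewrite ?expn1 ?local_full.
Qed.

Lemma class_out_notin o (h : {set vert m}) f i : f \in class o h ->
  i < 12 -> nth false o i -> prt m i \notin h.
Proof.
move=> /classP[hf <- <-] i12; rewrite outsE // inE.
by apply: contra => /eqP ->.
Qed.

Lemma class_pattern o (h : {set vert m}) f : f \in class o h ->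
  tval o \in patterns /\ parities o (hole_counts h).
Proof.
by move=> /classP[hf <- <-]; rewrite outs_patterns // outs_parities.
Qed.

Lemma parities_one_out o h (c : 'I_6) :
  parities o h -> nth 0 h c == 0 -> ~~ one_out o c.
Proof.
move/allP/(_ c); rewrite mem_iota add0n ltn_ord => /(_ isT) /eqP <- /eqP ->.
by [].
Qed.

(** Chains with holes keep their ends and thus their number of matchings. Among the others at least
    one more is free, for an extra factor [U >= 2 ^ r]. *)
Lemma class_improves (o o' : 12.-tuple bool) (h : {set vert m}) :
  tval o' \in patterns -> improves o o' (hole_counts h) ->
  2 ^ r * #|class o h| <= #|class o' h|.
Proof.
move=> o'P /andP[/allP ends fr].
have [->|[f fo]] := set_0Vmem (class o h); first by rewrite cards0 muln0.
have [oP par] := class_pattern fo.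
have ends' (c : 'I_6) : if nth 0 (hole_counts h) c == 0 then ~~ one_out o' c
    else same_ends o o' c.
  by apply: ends; rewrite mem_iota add0n ltn_ord.
(* Ports marked by [o'] are no holes: their chain has none, or its ends agree with [o], which the
   matching [f] realizes. *)
have o'h i : i < 12 -> nth false o' i -> prt m i \notin h.
  move=> i12 o'i; have c6 : i./2 < 6 by lia.
  have := ends' (Ordinal c6); rewrite hole_counts0.
  case: ifP => [/eqP e _|_ /andP[/eqP e0 /eqP e1]].
    have /setP/(_ (port m (odd i))) := e; rewrite !inE => /negbT.
    rewrite (_ : prt m i = (Ordinal c6, port m (odd i))) //.
    by congr (_, _); apply: val_inj; rewrite /= inordK.
  apply: (class_out_notin fo) => //; move: o'i e0 e1 => /=.
  rewrite -[i]odd_double_half; case: (odd i) => /=.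
    by rewrite add1n /= uphalf_double => ? _ ->.
  by rewrite add0n doubleK => ? ->.
apply: leq_trans (card_class_ge o'P o'h).
apply: leq_trans (leq_mul (leqnn _) (card_class_le o h)) _.
rewrite !prod_local; first last.
- by move=> c; apply: parities_one_out.
- by move=> c c0; have := ends' c; rewrite c0.
rewrite mulnCA (eq_bigr (fun c : 'I_6 => if nth 0 (hole_counts h) c == 0 then 1
   else #|local_class o' h c|)); last first.
  move=> c _; have := ends' c; case: ifP => // _ /andP[/eqP e0 /eqP e1].
  by rewrite /local_class e0 e1.
have U0 : 0 < U by apply: leq_trans (card_free r); rewrite expn_gt0.
rewrite leq_mul2l; apply/orP; right; apply: leq_trans (leq_pexp2l U0 fr).
by rewrite expnS leq_mul2r (card_free r) orbT.
Qed.

Lemma hole_counts_set0 : hole_counts (set0 : {set vert m}) = nseq 6 0.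
Proof.
apply: (@eq_from_nth _ 0); rewrite ?size_mkseq // => c c6.
rewrite nth_nseq c6 nth_mkseq //; apply/eqP; rewrite cards_eq0.
by apply/eqP/setP => x; rewrite !inE.
Qed.

Lemma nth_nseq60 c : nth 0 (nseq 6 0) c = 0.
Proof. by rewrite nth_nseq; case: ifP. Qed.

Lemma perfect_class_le (o : 12.-tuple bool) :
  #|class o (set0 : {set vert m})| <= U ^ 4.
Proof.
have [->|[f fo]] := set_0Vmem (class o (set0 : {set vert m})).
  by rewrite cards0.
have [oP par] := class_pattern fo.
apply: leq_trans (card_class_le o set0) _.
rewrite prod_local; last by move=> c; apply: parities_one_out.
rewrite hole_counts_set0 big1 ?mul1n; last by move=> c _; rewrite nth_nseq60.
have U0 : 0 < U by apply: leq_trans (card_free r); rewrite expn_gt0.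
apply: leq_pexp2l => //.
have /implyP := allP check_freeT _ oP; apply; apply/allP => c; rewrite mem_iota.
move=> /andP[_ c6]; apply: (@parities_one_out _ _ (Ordinal c6)) par _.
by rewrite hole_counts_set0 nth_nseq60.
Qed.

Lemma perfect_class_ge (o : 12.-tuple bool) : tval o \in patterns ->
  (forall c : 'I_6, ~~ one_out o c) -> free_chains o (nseq 6 0) = 4 ->
  U ^ 4 <= #|class o (set0 : {set vert m})|.
Proof.
move=> oP oc f4; apply: leq_trans (card_class_ge oP _); last first.
  by move=> i _ _; rewrite inE.
rewrite prod_local; last by move=> c _; exact: oc.
rewrite hole_counts_set0 big1 ?mul1n; last by move=> c _; rewrite nth_nseq60.
by rewrite f4.
Qed.

Definition state_outs (M : state G) : 12.-tuple bool := outs (mate (val M)).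

Lemma state_class (M : state G) :
  mate (val M) \in class (state_outs M) (holes (val M)).
Proof.
have hM := in_Omega_matching (valP M).
apply/classP; split=> //; first exact: mate_involutive.
by apply/setP => x; rewrite inE (holesP hM).
Qed.

(** States correspond to their mate functions; the assumption on [h] puts the matching of every
    function of the class into the state space. *)
Lemma card_state_class (o : 12.-tuple bool) (h : {set vert m}) :
  (#|h| == 0) || (#|h| == 2) ->
  #|[set M : state G | (holes (val M) == h) && (state_outs M == o)]| = #|class o h|.
Proof.
move=> ch; apply/eqP; rewrite eqn_leq; apply/andP; split.
  rewrite -(card_in_imset (f := fun M : state G => mate (val M))).
    apply: subset_leq_card; apply/fintype.subsetP => _ /imsetP[M hM ->].
    by move: hM; rewrite inE => /andP[/eqP <- /eqP <-]; exact: state_class.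
  move=> M M' _ _ e; apply: val_inj.
  rewrite -(mateM_of (in_Omega_matching (valP M))) e mateM_of //.
  exact: in_Omega_matching (valP M').
have fO f : f \in class o h -> in_Omega (of_mate (G := G) f).
  move=> /classP[hf hh _]; rewrite in_OmegaE of_mate_matching //=.
  by rewrite holes_of // hh.
have [->|[f0 f0c]] := set_0Vmem (class o h); first by rewrite cards0.
(* [M0] serves as the default value of [insubd]. *)
pose M0 : state G := Sub _ (fO _ f0c).
pose g f : state G := insubd M0 (of_mate (G := G) f).
have gE f : f \in class o h -> val (g f) = of_mate (G := G) f.
  by move=> fc; rewrite /g val_insubd fO.
rewrite -(card_in_imset (f := g) (D := class o h)); last first.
  move=> f f' fc fc' gg.
  have e : of_mate (G := G) f = of_mate (G := G) f' by rewrite -(gE f fc) gg gE.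
  case/classP: fc => hf _ _; case/classP: fc' => hf' _ _.
  by rewrite -(mate_of hf) e mate_of.
apply: subset_leq_card; apply/fintype.subsetP => _ /imsetP[f fc ->].
rewrite inE /state_outs (gE f fc); case/classP: fc => hf hh ho.
by rewrite holes_of // mate_of // hh ho !eqxx.
Qed.

Lemma card_outs (A : {set state G}) (k b : nat) :
  (forall o, k * #|[set M in A | state_outs M == o]| <= b) -> k * #|A| <= 2 ^ 12 * b.
Proof.
move=> Ab; rewrite -sum1_card (partition_big state_outs predT) //= big_distrr /=.
have <- : #|{: 12.-tuple bool}| = 2 ^ 12 by rewrite card_tuple card_bool.
rewrite -sum_nat_const; apply: leq_sum => o _.
by rewrite sum1dep_card.
Qed.

Lemma sumn_hole_counts (h : {set vert m}) : sumn (hole_counts h) = #|h|.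
Proof.
rewrite sumnE big_map -[iota 0 6]/(index_iota 0 6) big_mkord.
rewrite -sum1_card (partition_big (fun x : vert m => x.1) predT) //=.
by apply: eq_bigr => c _; rewrite sum1dep_card.
Qed.

Lemma state_card (M : state G) : (#|holes (val M)| == 0) || (#|holes (val M)| == 2).
Proof. by have := valP M; rewrite in_OmegaE => /andP[]. Qed.

Definition state_config (M : state G) : seq bool * seq nat :=
  (tval (state_outs M), hole_counts (holes (val M))).

Lemma state_configurations (M : state G) : state_config M \in configurations.
Proof.
have [oP par] := class_pattern (state_class M).
have hin : hole_counts (holes (val M)) \in [seq h <- natseqs 2 6 | holes_ok h].
  rewrite mem_filter /holes_ok sumn_hole_counts state_card /=.
  have := @mem_natseqs 2 (hole_counts (holes (val M))); rewrite size_mkseq; apply.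
  by rewrite sumn_hole_counts; case/orP: (state_card M) => /eqP ->.
rewrite mem_filter par /state_config; exact: (allpairs_f pair oP hin).
Qed.

(** * The bottleneck around the inner states *)

Definition inner_states : {set state G} := [set M | inside (state_outs M)].

Definition bottleneck : {set state G} :=
  [set M | suboptimal (state_config M).1 (state_config M).2].

(** Every move is centred at one vertex [x]: another vertex changes its mate only by losing [x] and
    becoming a hole, or by being a hole and gaining [x]. *)
Lemma mate_step_local (f f' : {ffun G -> G}) : involutive_matching f ->
  involutive_matching f' -> mate_step f f' -> exists x, forall y, f y <> f' y ->
  y = x \/ (f y = x /\ f' y = y) \/ (f' y = x /\ f y = y).
Proof.
move=> hf hf' [x st]; exists x => y; case: st => [|[[fx ->]|[fx ->]]].
- case/and5P => _ _ /eqP h3 /eqP h4 /forallP /(_ y) /or4P[]/eqP.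
  + by left.
  + by move=> -> _; right; left; rewrite h4 invK.
  + by move=> -> _; right; right; rewrite h3 invK.
  + by [].
- rewrite ffunE; have [->|yx] := eqVneq y x; first by left.
  have [->|yfx] /= := eqVneq y (f x); last by [].
  by move=> _; right; left; split=> //; exact: invK hf x.
- rewrite ffunE; have [->|yx] := eqVneq y x; first by left.
  have [->|yfx] /= := eqVneq y (f' x); last by [].
  by move=> _; right; right; split=> //; exact: invK hf' x.
Qed.

Lemma state_step (M M' : state G) : mate_step (mate (val M)) (mate (val M')) ->
  pattern_step (state_outs M) (state_outs M') (hole_counts (holes (val M))).
Proof.
have hM := in_Omega_matching (valP M); have hM' := in_Omega_matching (valP M').
rewrite /state_outs.
have holeP := holesP hM.
move: (mate_involutive hM) (mate_involutive hM') holeP.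
set f := mate (val M); set f' := mate (val M') => hf hf' holeP.
move=> /(mate_step_local hf hf')[x loc].
have K := invK hf; have K' := invK hf'.
apply/andP; split.
  (* A port other than the centre [x] changes its status only if its old or new mate is [x], lying
     in another chain and hence in the same triangle. *)
  apply/hasP; exists (triangle (port_index x)).
    have := port_index_lt x; case: (port_index x) => [|k]; first by [].
    by do 11![case: k => [|k] //].
  apply/allP => i; rewrite mem_iota add0n => /andP[_ i12].
  rewrite !outsE //; apply/orP.
  have [|ff] := eqVneq (f (prt m i)) (f' (prt m i)); first by move=> ->; right.
  have [e|[[e e']|[e e']]] := loc _ (elimN eqP ff).
  - by left; rewrite -e prtK.
  - rewrite e'; have [ee|ne] := eqVneq (f (prt m i)).1 (prt m i).1.
      by right; rewrite eqxx.
    by left; have [_ _] := mate_out hf ne; rewrite prtK // e => ->.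
  - rewrite e'; have [ee|ne] := eqVneq (f' (prt m i)).1 (prt m i).1.
      by right; rewrite eqxx.
    by left; have [_ _] := mate_out hf' ne; rewrite prtK // e => ->.
apply/allP => i; rewrite mem_iota add0n => /andP[_ i12].
apply/allP => j; rewrite mem_iota add0n => /andP[_ j12].
rewrite !outsE // !negbK; apply/implyP => /and4P[/eqP fi f'i fj /eqP f'j].
have c6 : i./2 < 6 by lia.
have ci := hole_counts0 (holes (val M)) (Ordinal c6).
rewrite [nat_of_ord _]/= in ci; rewrite ci.
suff : f (prt m i) = prt m i.
  move=> fix_i; apply/set0Pn; exists (port m (odd i)).
  rewrite inE (_ : (_, _) = prt m i) ?holeP ?fix_i //.
  by congr (_, _); apply: val_inj; rewrite /= inordK.
have ne : f (prt m i) <> f' (prt m i) by move=> e; rewrite -e fi eqxx in f'i.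
(* Port [i] either gains the mate [x], and then was a hole, or is the centre. In the latter case [j]
   would be its former mate in another chain, while [i] was not matched outside. *)
have [xi|[[_ e']|[_ //]]] := loc _ ne; last by rewrite e' eqxx in f'i.
have ne' : f (prt m j) <> f' (prt m j) by move=> e; rewrite e f'j eqxx in fj.
have [xj|[[e _]|[_ e']]] := loc _ ne'.
- by move: fj; rewrite xj -xi fi eqxx.
- by move: fi fj; rewrite xi e -{1}e K => ->; rewrite eqxx.
- by rewrite e' eqxx in fj.
Qed.

Lemma inner_boundary (M M' : state G) :
  M \in inner_states -> M' \notin inner_states ->
  mate_step (mate (val M)) (mate (val M')) -> M' \in bottleneck.
Proof.
rewrite !inE => iM iM' /state_step st; apply/negPn/negP => so.
have cM : state_config M \in [seq s <- configurations | inside s.1].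
  by rewrite mem_filter; apply/andP; split; [exact: iM|exact: state_configurations].
have cM' : state_config M' \in [seq s <- [seq s <- configurations | ~~ inside s.1]
    | ~~ suboptimal s.1 s.2].
  rewrite mem_filter; apply/andP; split; first exact: so.
  by rewrite mem_filter; apply/andP; split; [exact: iM'|exact: state_configurations].
by have := allP (allP check_boundaryT _ cM) _ cM'; rewrite st.
Qed.

(** For each port pattern in the bottleneck with these holes, an improving pattern supplies [2 ^ r]
    times as many states. Summing over the port patterns costs the factor [2 ^ 12]. *)
Lemma bottleneck_count (M : state G) : M \in bottleneck ->
  2 ^ r * #|[set N in bottleneck | holes (val N) == holes (val M)]| <=
  2 ^ 12 * #|[set N : state G | holes (val N) == holes (val M)]|.
Proof.
move=> MB; set h := holes (val M); apply: card_outs => o.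
set A := [set N in _ | _].
have [->|[N]] := set_0Vmem A; first by rewrite cards0 muln0.
rewrite !inE => /andP[/andP[/hasP[q qP imp] /eqP hN] /eqP oN].
have {}imp : improves o q (hole_counts h) by rewrite -oN -hN; exact: imp.
have sz : size q == 12 by exact: allP check_shapeT _ qP.
apply: leq_trans (_ : 2 ^ r * #|class o h| <= _).
  rewrite leq_mul2l -card_state_class ?state_card //.
  by apply/orP; right; apply: subset_leq_card; apply/fintype.subsetP => N';
    rewrite !inE => /andP[/andP[_ ->] ->].
apply: leq_trans (class_improves (o' := Tuple sz) qP imp) _.
rewrite -card_state_class ?state_card //.
by apply: subset_leq_card; apply/fintype.subsetP => N'; rewrite !inE => /andP[].
Qed.

(** Four free chains are the maximum for perfect matchings, so [o] accounts for at least as many of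
    them as any other of the [2 ^ 12] patterns. *)
Lemma perfect_count (o : 12.-tuple bool) : tval o \in patterns ->
  (forall c : 'I_6, ~~ one_out o c) -> free_chains o (nseq 6 0) = 4 ->
  #|[set M : state G | perfect (val M)]| <=
  2 ^ 12 * #|[set M : state G | perfect (val M) && (state_outs M == o)]|.
Proof.
have perfE (M : state G) : perfect (val M) = (holes (val M) == set0).
  by rewrite perfectE (in_Omega_matching (valP M)) cards_eq0.
move=> oP oc f4; rewrite -[leqLHS]mul1n; apply: card_outs => o'; rewrite mul1n.
have cE o'' : #|[set M : state G | perfect (val M) && (state_outs M == o'')]| =
    #|class o'' (set0 : {set vert m})|.
  rewrite -card_state_class ?cards0 //; apply: eq_card => M.
  by rewrite !inE perfE.
rewrite cE; apply: leq_trans (perfect_class_ge oP oc f4).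
apply: leq_trans (perfect_class_le o'); rewrite -cE.
by apply: subset_leq_card; apply/fintype.subsetP => M; rewrite !inE.
Qed.

End Counting.


(** * From counts to stationary probabilities and mixing time *)

Section Weights.
Local Open Scope ring_scope.
Variables (R : realType) (r : nat).
Notation G := (gadget r.*2).
Variable w : state G -> R.
Hypothesis hw : jsv_weight w.

Lemma card_gadget : #|G| = (12 * r.*2.+1)%N.
Proof. by rewrite !card_prod !card_ord card_bool; lia. Qed.

(** All chains are full here. Hence a small probability of the perfect matchings is never due to
    their absence. *)
Lemma perfect_gadget : exists M : {set {set G}}, perfect M.
Proof.
pose f : {ffun G -> G} := [ffun x : G => (x.1, (x.2.1, ~~ x.2.2))].
have fne x : f x != x.
  by rewrite ffunE; case: x => c [i b]; apply/eqP => -[]; case: b.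
have hf : involutive_matching f.
  apply/forallP => x; rewrite (negbTE (fne x)) /= !ffunE /= negbK.
  case: x => c [i b] /=; rewrite eqxx /gadj /= eqxx /hadj /=.
  by case: b => /=; rewrite leqnn.
exists (of_mate f); rewrite perfectE of_mate_matching // holes_of // cards_eq0.
by apply/eqP/setP => x; rewrite !inE; exact/negbTE.
Qed.

Lemma bottleneck_weight : 2 ^+ r * \sum_(M in bottleneck r) stationary w M <= 2 ^+ 12.
Proof.
have [M pM] := perfect_gadget.
have OM : in_Omega M by rewrite /in_Omega pM.
have := bottleneck_weight_le hw (Sub M OM : state G) (@bottleneck_count r).
by rewrite !natrX.
Qed.

(** The bottleneck has probability at most [2 ^ 12 / 2 ^ r], and the inner states and their
    complement each at least [p / 2 ^ 12]. With the factor 1/4 from the conductance bound, the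
    exponent is [26 = 12 + 12 + 2]. *)
Lemma gadget_mixing (T : R) : 0 <= T -> 0 < stationary_perfect w ->
  T * 2 ^+ 26 < 2 ^+ r * stationary_perfect w -> (T%:E <= jsv_mixing_time w)%E.
Proof.
move=> T0 P0 hT; set p := stationary_perfect w in P0 hT.
have G0 : (0 < #|G|)%N by rewrite card_gadget.
have part (o : seq bool) (so : size o == 12%N) (B : {set state G}) :
    o \in patterns -> all (fun c => ~~ one_out o c) (iota 0 6) ->
    free_chains o (nseq 6 0%N) = 4%N ->
    (forall M : state G, tval (state_outs M) = o -> M \in B) ->
    p <= 2 ^+ 12 * \sum_(M in B) stationary w M.
  move=> oP /allP oc f4 oB.
  have oc' (c : 'I_6) : ~~ one_out (Tuple so) c.
    by apply: oc; rewrite mem_iota add0n ltn_ord.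
  have cnt := perfect_count r (o := Tuple so) oP oc' f4.
  apply: le_trans (perfect_weight_ge hw _ cnt) _.
    by move=> M; rewrite inE => /andP[].
  rewrite natrX; apply: ler_wpM2l; first by rewrite exprn_ge0.
  rewrite
    [leRHS](big_setID [set M : state G |
       perfect (val M) && (state_outs M == Tuple so)]) /=.
  rewrite (setIidPr _); last first.
    by apply/fintype.subsetP => M; rewrite inE => /andP[_ /eqP e]; apply: oB; rewrite e.
  by rewrite lerDl sumr_ge0 // => M _; exact: stationary_ge0.
(* Chains 0 and 1 are full and the other four free, which gives inner states. *)
have pin := part (nseq 4 false ++ nseq 8 true)
  isT (inner_states r) isT isT erefl.
(* Chains 2 and 3 are full instead, so these matchings are not inner states. *)
have pout := part (nseq 4 true ++ nseq 4 false ++ nseq 4 true)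
  isT (~: inner_states r) isT isT erefl.
apply: (@jsv_bottleneck _ _ _ hw G0 (inner_states r) (bottleneck r) (p / 2 ^+ 12)) => //.
- by move=> M M'; exact: inner_boundary.
- by rewrite divr_gt0 // exprn_gt0.
- rewrite ler_pdivrMr ?exprn_gt0 // mulrC; apply: pin => M e; by rewrite inE e.
- rewrite ler_pdivrMr ?exprn_gt0 // mulrC; apply: pout => M e; by rewrite !inE e.
have := @bottleneck_weight; set b := \sum_(M in _) _ => hb.
have r0 : 0 < 2 ^+ r :> R by rewrite exprn_gt0.
rewrite -(ltr_pM2l r0) mulrCA.
apply: (@le_lt_trans _ _ (T * 2 ^+ 12)); first by rewrite ler_wpM2l.
have e26 : 2 ^+ 26 = 2 ^+ 12 * (4 * 2 ^+ 12) :> R.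
  have -> : 4 = 2 ^+ 2 :> R by rewrite expr2 -natrM.
  by rewrite -!exprD.
have K0 : 0 < 4 * 2 ^+ 12 :> R by rewrite mulr_gt0 // exprn_gt0.
have -> : 2 ^+ r * (4^-1 * (p / 2 ^+ 12)) = 2 ^+ r * p / (4 * 2 ^+ 12).
  by rewrite [(4 * _)^-1]invfM [RHS]mulrACA mulrA.
by rewrite ltr_pdivlMr // -mulrA -e26.
Qed.

End Weights.

(** * Choice of the constants *)

Local Open Scope classical_set_scope.
Local Open Scope ring_scope.

Theorem theorem3 (R : realType) :
  exists (c : R) (G : nat -> graph),
    [/\ 0 < c,
        (fun k => #|{: G k}|) @ \oo --> \oo &
        forall k,
          (exists M : {set {set G k}}, perfect M) /\
          forall w : state (G k) -> R, jsv_weight w ->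
            stationary_perfect w <= expR (- (c * #|{: G k}|%:R)) \/
            ((expR (c * #|{: G k}|%:R))%:E <= jsv_mixing_time w)%E].
Proof.
(* For [q = k + 14] the graph has [96q + 12 <= 108q] vertices. *)
pose c : R := ln 2 / 108.
have ln2 : 0 < ln (2 : R) by rewrite ln_gt0 // ltr1n.
(* The factor 4 splits [2 ^ r] into two factors [2 ^ (2q)], one to absorb [exp (2cn)] and one to
   absorb [2 ^ 26]; the shift by 14 ensures [26 <= 2q]. *)
exists c, (fun k => gadget (4 * (k + 14)).*2); split.
- by rewrite divr_gt0.
- apply/cvgnyPge => n; near=> k.
  rewrite card_gadget; have : (n <= k)%N by near: k; exact: nbhs_infty_ge.
  lia.
move=> k; split; first exact: perfect_gadget.
set q := (k + 14)%N; set r := (4 * q)%N => w hw.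
have [small|big] := leP (stationary_perfect w) (expR (- (c * #|{: gadget r.*2}|%:R))).
  by left.
right; set n := #|{: gadget r.*2}| in big *.
have nE : n = (96 * q + 12)%N by rewrite /n card_gadget /r; lia.
have eP : 0 < expR (c * n%:R) by exact: expR_gt0.
have eN : expR (c * n%:R) * expR (- (c * n%:R)) = 1 :> R.
  by rewrite -expRD subrr expR0.
(* [e^(2cn) <= 4^q] because [n <= 108 q] *)
have e2 : expR (c * n%:R) * expR (c * n%:R) <= 2 ^+ (2 * q) :> R.
  have -> : 2 ^+ (2 * q) = expR ((2 * q)%:R * ln 2) :> R.
    by rewrite expRM_natl lnK // posrE.
  rewrite -expRD ler_expR /c -mulrDr -natrD -mulrA mulrC ler_pM2r //.
  rewrite ler_pdivrMl // -natrM ler_nat; lia.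
apply: gadget_mixing => //.
- by apply: le_lt_trans big; exact: expR_ge0.
have P26 : 2 ^+ 26 <= 2 ^+ (2 * q) :> R by rewrite ler_weXn2l // ?ler1n //; lia.
have rE : 2 ^+ r = 2 ^+ (2 * q) * 2 ^+ (2 * q) :> R.
  by rewrite -exprD; congr (_ ^+ _); lia.
(* After multiplication by [exp (cn)], strictness comes from
   [exp (cn) * stationary_perfect w > 1]. *)
rewrite -(ltr_pM2l eP) mulrA rE.
apply: (@le_lt_trans _ _ (2 ^+ (2 * q) * 2 ^+ (2 * q))).
  by rewrite ler_pM // ?mulr_ge0 ?exprn_ge0 ?ltW.
rewrite [ltRHS]mulrCA -[ltLHS]mulr1 ltr_pM2l ?mulr_gt0 ?exprn_gt0 //.
by rewrite -[ltLHS]eN ltr_pM2l.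
Unshelve. all: by end_near.
Qed.
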